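(* (1) The spherical double affine Hecke algebra $e\mathbb{H}_{t,q}e$ is isomorphic to the $k$-algebra $\mathcal{A}$ with generators $P_1,P_2^{\pm1},Q_1,Q_2^{\pm1},R$ and relations $$\begin{aligned} &P_2P_1=P_1P_2,\quad Q_2Q_1=Q_1Q_2,\quad P_2Q_2=q^{-4}Q_2P_2,\quad P_2Q_1=q^{-2}Q_1P_2,\quad P_1Q_2=q^{-2}Q_2P_1,\\ &P_1Q_1=Q_1P_1+(q^{-2}-1)R,\quad P_2R=q^{-2}RP_2,\quad RQ_2=q^{-2}Q_2R,\\ &P_1R=q^{-2}RP_1+(1-q^{-2})Q_1P_2,\quad RQ_1=q^{-2}Q_1R+(1-q^{-2})Q_2P_1,\\ &R^2=(1+t^2)(q^{-2}+t^{-2})Q_2P_2-q^{-2}Q_2P_1^2-q^{-2}Q_1^2P_2+q^{-2}Q_1RP_1 . \end{aligned}$$ The isomorphism $\Phi:\mathcal{A}\to e\mathbb{H}_{t,q}e$ is given by $$\Phi(P_1)=e(X_1+X_2)e,\ \ \Phi(P_2)=e(X_1X_2)e,\ \ \Phi(Q_1)=e(Y_1+Y_2)e,\ \ \Phi(Q_2)=e(Y_1Y_2)e,\ \ \Phi(R)=e(t^{-2}Y_1X_1+Y_2X_2)e.$$ (2) After the identification given by $\Phi$, the set $$\{Q_1^{a_1}Q_2^{a_2}R^{\epsilon}P_1^{b_1}P_2^{b_2}\mid \epsilon\in\{0,1\},\ a_1,b_1\in\mathbb{N}_0,\ a_2,b_2\in\mathbb{Z}\}$$ forms a basis of $e\mathbb{H}_{t,q}e$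 over $k$.
   Context: **Ground ring.** $k$ is either $R_{t,q}=\mathbb{C}[t^{\pm1},q^{\pm1}][(t^2+1)^{-1}]$ with $q,t$ indeterminates, or $\mathbb{C}$ with $q,t\in\mathbb{C}^\times$, $t^2+1\ne0$. **DAHA.** $\mathbb{H}_{t,q}$ is the associative $k$-algebra generated by $T^{\pm1},X_1^{\pm1},X_2^{\pm1},Y_1^{\pm1},Y_2^{\pm1}$ with relations $TX_1T=X_2$, $T^{-1}Y_1T^{-1}=Y_2$, $X_1X_2=X_2X_1$, $Y_1Y_2=Y_2Y_1$, $Y_1X_1X_2=q^2X_1X_2Y_1$, $X_1^{-1}Y_2=Y_2X_1^{-1}T^{-2}$, $(T+t^{-1})(T-t)=0$. Put $e=\frac{1+tT}{1+t^2}\in\mathbb{H}_{t,q}$, an idempotent. The spherical double affine Hecke algebra is $e\mathbb{H}_{t,q}e$, an algebra with unit $e$. *)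

(* Defs.v *)
From HB Require Import structures.
From mathcomp Require Import all_boot all_order all_algebra.
From mathcomp Require Import generic_quotient fraction.
From mathcomp Require Import boolp reals.
From mathcomp Require Export complex.

Set Implicit Arguments.
Unset Strict Implicit.
Unset Printing Implicit Defensive.

Import GRing.Theory.
Local Open Scope ring_scope.
Local Open Scope quotient_scope.

(* A [k]-algebra is a ring with a ring morphism from [k] to its centre; the
   scalar action of [c] is the product with [algin c].  MathComp's [algType]
   requires [1 != 0], which for an algebra given by generators and relations is
   a theorem and not part of the definition. *)
HB.mixin Record isPzAlgebra (k : comNzRingType) A of GRing.PzRing A := {
  algin : k -> A;
  algin_zmod_subproof : zmod_morphism algin;
  algin_monoid_subproof : monoid_morphism algin;
  algin_comm : forall (c : k) (x : A), algin c * x = x * algin c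
}.

#[short(type="pzAlgType")]
HB.structure Definition PzAlgebra (k : comNzRingType) :=
  {A of GRing.PzRing A & isPzAlgebra k A}.

HB.instance Definition _ (k : comNzRingType) (A : pzAlgType k) :=
  GRing.isZmodMorphism.Build k A (@algin k A) (@algin_zmod_subproof k A).
HB.instance Definition _ (k : comNzRingType) (A : pzAlgType k) :=
  GRing.isMonoidMorphism.Build k A (@algin k A) (@algin_monoid_subproof k A).

Definition alg_iso (k : comNzRingType) (A B : pzAlgType k)
    (f : {rmorphism A -> B}) :=
  (forall c : k, f (algin c) = algin c) /\ bijective f.

Definition is_basis (k : comNzRingType) (A : pzAlgType k) (J : eqType)
    (b : J -> A) :=
  (forall (s : seq J) (c : J -> k), uniq s ->
     \sum_(j <- s) algin (c j) * b j = 0 -> forall j, j \in s -> c j = 0) /\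
  (forall x : A, exists (s : seq J) (c : J -> k),
     x = \sum_(j <- s) algin (c j) * b j).

Inductive term (k : Type) (I : Type) : Type :=
| Var of I
| Cst of k
| Add of term k I & term k I
| Mul of term k I & term k I.
Arguments Var {k I}.
Arguments Cst {k I}.

Declare Scope pres_scope.
Delimit Scope pres_scope with pres.
Bind Scope pres_scope with term.
Notation "x + y" := (Add x y) : pres_scope.
Notation "x * y" := (Mul x y) : pres_scope.
Notation "c *: x" := (Mul (Cst c%R) x) : pres_scope.
Notation "x - y" := (Add x (Mul (Cst (-1)%R) y)) : pres_scope.
Notation "0" := (Cst 0%R) : pres_scope.
Notation "1" := (Cst 1%R) : pres_scope.

Section Presentation.
Variables (k : comNzRingType) (I : Type).
Variable rel : term k I -> term k I -> Prop.

(* The least congruence that contains [rel] and the axioms of an associative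
   unital [k]-algebra; the scalar [c] acts as multiplication by [Cst c]. *)
Inductive congr : term k I -> term k I -> Prop :=
| cg_rel x y : rel x y -> congr x y
| cg_refl x : congr x x
| cg_sym x y : congr x y -> congr y x
| cg_trans x y z : congr x y -> congr y z -> congr x z
| cg_add x x' y y' : congr x x' -> congr y y' -> congr (x + y) (x' + y')
| cg_mul x x' y y' : congr x x' -> congr y y' -> congr (x * y) (x' * y')
| cg_addA x y z : congr (x + (y + z)) (x + y + z)
| cg_addC x y : congr (x + y) (y + x)
| cg_add0 x : congr (0 + x) x
| cg_mulA x y z : congr (x * (y * z)) (x * y * z)
| cg_mul1 x : congr (1 * x) x
| cg_mul0 x : congr (0 * x) 0
| cg_mulDl x y z : congr ((x + y) * z) (x * z + y * z)
| cg_mulDr x y z : congr (x * (y + z)) (x * y + x * z)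
| cg_cstD a b : congr (Cst (a + b)%R) (Cst a + Cst b)
| cg_cstM a b : congr (Cst (a * b)%R) (Cst a * Cst b)
| cg_cstC a x : congr (Cst a * x) (x * Cst a).

HB.instance Definition _ := gen_eqMixin (term k I).
HB.instance Definition _ := gen_choiceMixin (term k I).

Definition congrb (x y : term k I) : bool := `[< congr x y >].

Lemma congrb_equiv : equiv_class_of congrb.
Proof.
split=> [x|x y|y x z]; first exact/asboolP/cg_refl.
- by apply/idP/idP => /asboolP h; apply/asboolP/cg_sym.
- by move=> /asboolP h1 /asboolP h2; apply/asboolP/(cg_trans h1 h2).
Qed.

Canonical congrb_equiv_rel := EquivRelPack congrb_equiv.

Definition presented := {eq_quot congrb}.
HB.instance Definition _ := Choice.on presented.
HB.instance Definition _ := Quotient.on presented.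

Definition cls (x : term k I) : presented := \pi_presented x.
Definition gen (i : I) : presented := cls (Var i).

Let add (x y : presented) := cls (repr x + repr y).
Let mul (x y : presented) := cls (repr x * repr y).
Let opp (x : presented) := cls ((-1) *: repr x).

Lemma clsP x y : cls x = cls y <-> congr x y.
Proof. by split=> [/eqquotP/asboolP|h]; last exact/eqquotP/asboolP. Qed.

Lemma repr_cls x : congr (repr (cls x)) x.
Proof. by apply/clsP; rewrite /cls reprK. Qed.

Lemma clsW (P : presented -> Prop) : (forall x, P (cls x)) -> forall x, P x.
Proof. by move=> h x; rewrite -[x]reprK; apply: h. Qed.

Let clsD x y : add (cls x) (cls y) = cls (x + y).
Proof. by apply/clsP/cg_add; apply: repr_cls. Qed.

Let clsM x y : mul (cls x) (cls y) = cls (x * y).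
Proof. by apply/clsP/cg_mul; apply: repr_cls. Qed.

Let clsN x : opp (cls x) = cls ((-1) *: x).
Proof. by apply/clsP/cg_mul; [apply: cg_refl | apply: repr_cls]. Qed.

Let addA : associative add.
Proof.
elim/clsW=> x; elim/clsW=> y; elim/clsW=> z.
by rewrite !clsD; apply/clsP/cg_addA.
Qed.

Let addC : commutative add.
Proof. by elim/clsW=> x; elim/clsW=> y; rewrite !clsD; apply/clsP/cg_addC. Qed.

Let add0 : left_id (cls 0) add.
Proof. by elim/clsW=> x; rewrite clsD; apply/clsP/cg_add0. Qed.

Let addN : left_inverse (cls 0) opp add.
Proof.
elim/clsW=> x; rewrite clsN clsD; apply/clsP.
apply: (cg_trans (y := (-1) *: x + 1 *: x)).
  by apply: cg_add; [apply: cg_refl | apply/cg_sym/cg_mul1].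
apply: cg_trans (cg_sym (cg_mulDl _ _ _)) _.
apply: cg_trans (cg_mul0 x); apply: cg_mul; last exact: cg_refl.
by apply: cg_trans (cg_sym (cg_cstD _ _)) _; rewrite addNr; apply: cg_refl.
Qed.

HB.instance Definition _ :=
  GRing.isZmodule.Build presented addA addC add0 addN.

Let mulA : associative mul.
Proof.
elim/clsW=> x; elim/clsW=> y; elim/clsW=> z.
by rewrite !clsM; apply/clsP/cg_mulA.
Qed.

Let mul1l : left_id (cls 1) mul.
Proof. by elim/clsW=> x; rewrite clsM; apply/clsP/cg_mul1. Qed.

Let mul1r : right_id (cls 1) mul.
Proof.
elim/clsW=> x; rewrite clsM; apply/clsP.
exact: cg_trans (cg_sym (cg_cstC _ _)) (cg_mul1 _).
Qed.

Let mulDl : left_distributive mul +%R.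
Proof.
elim/clsW=> x; elim/clsW=> y; elim/clsW=> z.
apply: etrans (etrans (congr1 (mul^~ _) (clsD _ _)) (clsM _ _)) _.
apply: etrans (esym (etrans (congr2 add (clsM _ _) (clsM _ _)) (clsD _ _))).
exact/clsP/cg_mulDl.
Qed.

Let mulDr : right_distributive mul +%R.
Proof.
elim/clsW=> x; elim/clsW=> y; elim/clsW=> z.
apply: etrans (etrans (congr1 (mul _) (clsD _ _)) (clsM _ _)) _.
apply: etrans (esym (etrans (congr2 add (clsM _ _) (clsM _ _)) (clsD _ _))).
exact/clsP/cg_mulDr.
Qed.

HB.instance Definition _ :=
  GRing.Zmodule_isPzRing.Build presented mulA mul1l mul1r mulDl mulDr.

Definition cst (c : k) : presented := cls (Cst c).

Let cst_zmod : zmod_morphism cst.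
Proof.
move=> a b; apply/eqP; rewrite eq_sym subr_eq; apply/eqP.
apply: etrans (esym (clsD _ _)); apply/clsP; rewrite -{1}[a](subrK b).
exact: cg_cstD.
Qed.

Let cst_monoid : monoid_morphism cst.
Proof. by split=> // a b; apply: etrans (esym (clsM _ _)); apply/clsP/cg_cstM. Qed.

Let cst_comm (c : k) (x : presented) : (cst c * x = x * cst c)%R.
Proof.
elim/clsW: x => x; apply: etrans (clsM _ _) _.
apply: etrans (esym (clsM _ _)); exact/clsP/cg_cstC.
Qed.

HB.instance Definition _ :=
  isPzAlgebra.Build k presented cst_zmod cst_monoid cst_comm.

Lemma cls_add x y : cls (x + y) = (cls x + cls y)%R.
Proof. by rewrite -clsD. Qed.

Lemma cls_mul x y : cls (x * y) = (cls x * cls y)%R.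
Proof. by rewrite -clsM. Qed.

Lemma cls_cst c : cls (Cst c) = algin c.
Proof. by []. Qed.

End Presentation.

Record idempotent (k : comNzRingType) (A : pzAlgType k) := Idempotent {
  idem_val : A;
  idemP : idem_val * idem_val = idem_val
}.

Section Corner.
Variables (k : comNzRingType) (A : pzAlgType k) (i : idempotent A).
Local Notation e := (idem_val i).

Definition corner_pred : {pred A} :=
  fun x => `[< exists h : A, x = e * h * e >].

Record corner := Corner { corner_val : A; _ : corner_val \in corner_pred }.

Fact corner_zmod : zmod_closed corner_pred.
Proof.
split; first by apply/asboolP; exists 0; rewrite mulr0 mul0r.
move=> _ _ /asboolP[x ->] /asboolP[y ->]; apply/asboolP.
by exists (x - y); rewrite mulrBr mulrBl.
Qed.
HB.instance Definition _ := GRing.isZmodClosed.Build A corner_pred corner_zmod.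

HB.instance Definition _ := [isSub for corner_val].
HB.instance Definition _ := [Choice of corner by <:].
HB.instance Definition _ := [SubChoice_isSubZmodule of corner by <:].

Fact cornerM_subproof (x y : corner) : val x * val y \in corner_pred.
Proof.
case: x y => [_ /= /asboolP[x ->]] [_ /= /asboolP[y ->]]; apply/asboolP.
by exists (x * e * e * y); rewrite !mulrA.
Qed.

Fact corner1_subproof : e \in corner_pred.
Proof. by apply/asboolP; exists 1; rewrite mulr1 idemP. Qed.

Fact corner_in_subproof (h : A) : e * h * e \in corner_pred.
Proof. by apply/asboolP; exists h. Qed.

Definition corner_in (h : A) : corner := Corner (corner_in_subproof h).

Let mul (x y : corner) := Corner (cornerM_subproof x y).
Let one := Corner corner1_subproof.

Lemma corner_mull (x : corner) : e * val x = val x.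
Proof. by case: x => [_ /= /asboolP[x ->]]; rewrite !mulrA idemP. Qed.

Lemma corner_mulr (x : corner) : val x * e = val x.
Proof. by case: x => [_ /= /asboolP[x ->]]; rewrite -!mulrA idemP. Qed.

Let mulA : associative mul.
Proof. by move=> x y z; apply: val_inj; rewrite /= mulrA. Qed.
Let mul1l : left_id one mul.
Proof. by move=> x; apply: val_inj; apply: corner_mull. Qed.
Let mul1r : right_id one mul.
Proof. by move=> x; apply: val_inj; apply: corner_mulr. Qed.
Let mulDl : left_distributive mul +%R.
Proof. by move=> x y z; apply: val_inj; rewrite /= mulrDl. Qed.
Let mulDr : right_distributive mul +%R.
Proof. by move=> x y z; apply: val_inj; rewrite /= mulrDr. Qed.

HB.instance Definition _ :=
  GRing.Zmodule_isPzRing.Build corner mulA mul1l mul1r mulDl mulDr.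

Let cst (c : k) : corner := corner_in (algin c).

Let cstE c : e * algin c * e = algin c * e.
Proof. by rewrite -algin_comm -mulrA idemP. Qed.

Let cst_zmod : zmod_morphism cst.
Proof. by move=> a b; apply: val_inj; rewrite /= rmorphB mulrBr mulrBl. Qed.
Let cst_monoid : monoid_morphism cst.
Proof.
split=> [|a b]; apply: val_inj; rewrite /=; first by rewrite rmorph1 mulr1 idemP.
by rewrite !cstE rmorphM -!mulrA [e * (algin b * e)]mulrA cstE.
Qed.
Let cst_comm (c : k) (x : corner) : cst c * x = x * cst c.
Proof.
apply: val_inj; rewrite /= cstE -mulrA corner_mull mulrA algin_comm.
by rewrite -[RHS]mulrA algin_comm [RHS]mulrA corner_mulr.
Qed.

HB.instance Definition _ :=
  isPzAlgebra.Build k corner cst_zmod cst_monoid cst_comm.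

End Corner.

Section Denominator.
Variables (K : fieldType) (t q : K).

Definition den (a b c : nat) : K := t ^+ a * q ^+ b * (t ^+ 2 + 1) ^+ c.

Lemma den_neq0 a b c : t != 0 -> q != 0 -> t ^+ 2 + 1 != 0 -> den a b c != 0.
Proof.
move=> t0 q0 s0; rewrite /den mulf_eq0 negb_or (expf_neq0 c s0) andbT.
by rewrite mulf_eq0 negb_or (expf_neq0 a t0) (expf_neq0 b q0).
Qed.

Lemma denM a b c a' b' c' :
  den a b c * den a' b' c' = den (a + a') (b + b') (c + c').
Proof. by rewrite /den !exprD mulrACA; congr (_ * _); rewrite mulrACA. Qed.

Lemma den0 : den 0 0 0 = 1.
Proof. by rewrite /den !expr0 !mulr1. Qed.

End Denominator.

(* [F[t^+-1, q^+-1][(t^2 + 1)^-1]], as the subring of the field [F(t)(q)] of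
   the fractions whose denominator is a product of powers of [t], [q] and
   [t^2 + 1].  In [{poly {poly F}}] the outer variable is [q]. *)
Section GenericRing.
Variable F : fieldType.

Local Notation frac := {fraction {poly {poly F}}}.
Local Notation qF := (tofrac 'X : frac).
Local Notation tF := (tofrac ('X%:P) : frac).

Definition Rtq_pred : {pred frac} := fun x =>
  `[< exists (p : {poly {poly F}}) (a b c : nat),
        x = tofrac p / den tF qF a b c >].

Record Rtq := MkRtq { Rtq_val : frac; _ : Rtq_val \in Rtq_pred }.

Let tF_neq0 : tF != 0.
Proof. by rewrite tofrac_eq0 polyC_eq0 polyX_eq0. Qed.

Let qF_neq0 : qF != 0.
Proof. by rewrite tofrac_eq0 polyX_eq0. Qed.

Let sF_neq0 : tF ^+ 2 + 1 != 0.
Proof.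
have E : ('X ^+ 2 + 1%:P : {poly F})%:P = 'X%:P ^+ 2 + 1.
  by rewrite rmorphD rmorphXn.
rewrite -tofracXn -tofrac1 -tofracD tofrac_eq0 -E polyC_eq0.
by rewrite -size_poly_eq0 size_XnaddC.
Qed.

Let dF_neq0 a b c : den tF qF a b c != 0.
Proof. exact: den_neq0 tF_neq0 qF_neq0 sF_neq0. Qed.

Let dFE a b c : den tF qF a b c =
  tofrac ('X%:P ^+ a * 'X ^+ b * ('X%:P ^+ 2 + 1) ^+ c).
Proof. by rewrite !(tofracM, tofracXn, tofracD, tofrac1). Qed.

Fact Rtq_subring : subring_closed Rtq_pred.
Proof.
split.
- apply/asboolP; exists 1, 0%N, 0%N, 0%N.
  by rewrite den0 divr1 tofrac1.
- move=> _ _ /asboolP[p [a [b [c ->]]]] /asboolP[p' [a' [b' [c' ->]]]].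
  apply/asboolP.
  exists (p * ('X%:P ^+ a' * 'X ^+ b' * ('X%:P ^+ 2 + 1) ^+ c')
       - p' * ('X%:P ^+ a * 'X ^+ b * ('X%:P ^+ 2 + 1) ^+ c)).
  exists (a + a')%N, (b + b')%N, (c + c')%N.
  rewrite -denM tofracB !(tofracM p) (tofracM p') -!dFE.
  by rewrite -mulNr (addf_div _ _ (dF_neq0 a b c) (dF_neq0 a' b' c')) mulNr.
- move=> _ _ /asboolP[p [a [b [c ->]]]] /asboolP[p' [a' [b' [c' ->]]]].
  apply/asboolP; exists (p * p'), (a + a')%N, (b + b')%N, (c + c')%N.
  by rewrite -denM tofracM mulf_div.
Qed.
HB.instance Definition _ := GRing.isSubringClosed.Build frac Rtq_pred
  Rtq_subring.

HB.instance Definition _ := [isSub for Rtq_val].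
HB.instance Definition _ := [Choice of Rtq by <:].
HB.instance Definition _ := [SubChoice_isSubComNzRing of Rtq by <:].

Definition Rtq_unit : {pred Rtq} :=
  fun x => (val x != 0) && ((val x)^-1 \in Rtq_pred).

Definition Rtq_inv (x : Rtq) : Rtq :=
  if x \in Rtq_unit then insubd x (val x)^-1 else x.

Fact Rtq_mulV : {in Rtq_unit, left_inverse 1 Rtq_inv *%R}.
Proof.
move=> x Ux; apply: val_inj; rewrite /Rtq_inv Ux rmorphM rmorph1 /=.
by case/andP: Ux => x0 Vx; rewrite -[Rtq_val _]/(val _) insubdK // mulVf.
Qed.

Fact Rtq_unitP (x y : Rtq) : y * x = 1 -> Rtq_unit x.
Proof.
move=> /(congr1 val); rewrite rmorphM rmorph1 /= => yx1.
have x0 : val x != 0.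
  by apply: contra_eq_neq yx1 => ->; rewrite mulr0 eq_sym oner_neq0.
apply/andP; split=> //.
by rewrite -[_^-1]mul1r -yx1 mulfK //; apply: valP.
Qed.

Fact Rtq_inv_out : {in [predC Rtq_unit], Rtq_inv =1 id}.
Proof. by move=> x; rewrite inE /Rtq_inv => /negbTE ->. Qed.

HB.instance Definition _ := GRing.ComNzRing_hasMulInverse.Build Rtq
  Rtq_mulV Rtq_unitP Rtq_inv_out.

Fact Rtq_t_subproof : tF \in Rtq_pred.
Proof. by apply/asboolP; exists 'X%:P, 0%N, 0%N, 0%N; rewrite den0 divr1. Qed.

Fact Rtq_q_subproof : qF \in Rtq_pred.
Proof. by apply/asboolP; exists 'X, 0%N, 0%N, 0%N; rewrite den0 divr1. Qed.

Definition Rtq_t : Rtq := MkRtq Rtq_t_subproof.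
Definition Rtq_q : Rtq := MkRtq Rtq_q_subproof.

Lemma Rtq_t_unit : Rtq_t \is a GRing.unit.
Proof.
apply/andP; split; first exact: tF_neq0.
apply/asboolP; exists 1, 1%N, 0%N, 0%N.
by rewrite tofrac1 div1r /den expr1 !expr0 !mulr1.
Qed.

Lemma Rtq_q_unit : Rtq_q \is a GRing.unit.
Proof.
apply/andP; split; first exact: qF_neq0.
apply/asboolP; exists 1, 0%N, 1%N, 0%N.
by rewrite tofrac1 div1r /den expr1 !expr0 mul1r mulr1.
Qed.

Lemma Rtq_s_unit : Rtq_t ^+ 2 + 1 \is a GRing.unit.
Proof.
have vE : val (Rtq_t ^+ 2 + 1) = tF ^+ 2 + 1.
  by rewrite rmorphD rmorphXn rmorph1.
apply/andP; rewrite vE; split; first exact: sF_neq0.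
apply/asboolP; exists 1, 0%N, 0%N, 1%N.
by rewrite tofrac1 div1r /den !expr0 expr1 !mul1r.
Qed.

End GenericRing.

(* [R[i]] is the field of complex numbers over the real numbers [R]. *)
Inductive ground_ring (R : realType) : forall k : comUnitRingType, k -> k -> Prop :=
| Ground_generic : ground_ring R (Rtq_t R[i]) (Rtq_q R[i])
| Ground_complex (t q : R[i]) :
    t != 0 -> q != 0 -> t ^+ 2 + 1 != 0 -> ground_ring R t q.

Lemma ground_ring_t_unit (R : realType) (k : comUnitRingType) (t q : k) :
  ground_ring R t q -> t \is a GRing.unit.
Proof. by case=> [|{}t {}q t0 q0 s0]; [exact: Rtq_t_unit | rewrite unitfE]. Qed.

Lemma ground_ring_s_unit (R : realType) (k : comUnitRingType) (t q : k) :
  ground_ring R t q -> t ^+ 2 + 1 \is a GRing.unit.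
Proof. by case=> [|{}t {}q t0 q0 s0]; [exact: Rtq_s_unit | rewrite unitfE]. Qed.

(* The suffix [V] marks the generator that is the inverse. *)
Inductive daha_gen := gT | gTV | gX1 | gX1V | gX2 | gX2V
                    | gY1 | gY1V | gY2 | gY2V.

Lemma idem_aux (A : pzRingType) (T u ui w : A) :
  GRing.comm u T -> GRing.comm w T -> GRing.comm w u -> u * ui = 1 ->
  ui * u = 1 -> (T + ui) * (T - u) = 0 -> w * (1 + u * u) = 1 ->
  w * (1 + u * T) * (w * (1 + u * T)) = w * (1 + u * T).
Proof.
move=> cuT cwT cwu uV Vu quad w1.
have TT : u * (u * (T * T)) = u * (u * (u * T)) - u * T + u * u.
  have : u * (u * ((T + ui) * (T - u))) = 0 by rewrite quad !mulr0.
  rewrite mulrDl !mulrBr Vu -cuT !mulrDr !mulrN mulr1 !(mulrA u ui) uV mul1r.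
  move/eqP; rewrite addr_eq0 opprB => /eqP/(canRL (subrK _)) ->.
  by rewrite addrC addrCA addrC addrC addrA addrAC.
have sq : (1 + u * T) * (1 + u * T) = (1 + u * u) * (1 + u * T).
  rewrite mulrDl mul1r mulrDr mulr1 -mulrA (mulrA T) -cuT -(mulrA u T) TT.
  rewrite [RHS]mulrDl mul1r [u * u * (1 + _)]mulrDr mulr1 -(mulrA u u).
  rewrite -[LHS]addrA -[RHS]addrA; do 2! congr (_ + _).
  by rewrite addrA [u * T + _]addrC subrK addrC.
have cw : GRing.comm w (1 + u * T).
  by apply: commrD; [apply: commr1 | apply: commrM].
rewrite [w * _ in X in _ * X]cw mulrA -(mulrA w) sq mulrA w1 mul1r.
exact/esym/cw.
Qed.

Section DAHA.
Variables (k : comUnitRingType) (t q : k).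

Local Notation V := (@Var k daha_gen) (only parsing).
Local Notation T := (V gT).
Local Notation TV := (V gTV).
Local Notation X1 := (V gX1).
Local Notation X1V := (V gX1V).
Local Notation X2 := (V gX2).
Local Notation X2V := (V gX2V).
Local Notation Y1 := (V gY1).
Local Notation Y1V := (V gY1V).
Local Notation Y2 := (V gY2).
Local Notation Y2V := (V gY2V).

Local Open Scope pres_scope.
Inductive daha_rel : term k daha_gen -> term k daha_gen -> Prop :=
| rel_T_TV : daha_rel (T * TV) 1
| rel_TV_T : daha_rel (TV * T) 1
| rel_X1_X1V : daha_rel (X1 * X1V) 1
| rel_X1V_X1 : daha_rel (X1V * X1) 1
| rel_X2_X2V : daha_rel (X2 * X2V) 1
| rel_X2V_X2 : daha_rel (X2V * X2) 1
| rel_Y1_Y1V : daha_rel (Y1 * Y1V) 1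
| rel_Y1V_Y1 : daha_rel (Y1V * Y1) 1
| rel_Y2_Y2V : daha_rel (Y2 * Y2V) 1
| rel_Y2V_Y2 : daha_rel (Y2V * Y2) 1
| rel_TXT : daha_rel (T * X1 * T) X2
| rel_TYT : daha_rel (TV * Y1 * TV) Y2
| rel_XX : daha_rel (X1 * X2) (X2 * X1)
| rel_YY : daha_rel (Y1 * Y2) (Y2 * Y1)
| rel_YXX : daha_rel (Y1 * X1 * X2) (q ^+ 2 *: (X1 * X2 * Y1))
| rel_XY : daha_rel (X1V * Y2) (Y2 * X1V * (TV * TV))
| rel_quad : daha_rel ((T + Cst t^-1) * (T - Cst t)) 0.
Local Close Scope pres_scope.

Definition daha := presented daha_rel.
HB.instance Definition _ := PzAlgebra.on daha.

Definition dgen (g : daha_gen) : daha := gen daha_rel g.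

Definition sph_e : daha :=
  algin (1 + t ^+ 2)^-1 * (1 + algin t * dgen gT).

Lemma sph_e_idem : t \is a GRing.unit -> t ^+ 2 + 1 \is a GRing.unit ->
  sph_e * sph_e = sph_e.
Proof.
move=> ht hs; apply: (@idem_aux _ _ _ (algin t^-1));
  rewrite -?rmorphM ?mulrV ?mulVr ?rmorph1 //; try exact: algin_comm.
- have /clsP := cg_rel rel_quad.
  by rewrite !(cls_add, cls_mul) !cls_cst rmorph0 rmorphN1 mulN1r.
- by rewrite -(rmorph1 (@algin k daha)) -rmorphD -rmorphM -expr2 mulVr // addrC.
Qed.

End DAHA.

Definition sph_idem (R : realType) (k : comUnitRingType) (t q : k)
    (hk : ground_ring R t q) : idempotent (daha t q) :=
  Idempotent (sph_e_idem q (ground_ring_t_unit hk) (ground_ring_s_unit hk)).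

Inductive sph_gen := gP1 | gP2 | gP2V | gQ1 | gQ2 | gQ2V | gR.

Section SphPresentation.
Variables (k : comUnitRingType) (t q : k).

Local Notation V := (@Var k sph_gen) (only parsing).
Local Notation P1 := (V gP1).
Local Notation P2 := (V gP2).
Local Notation P2V := (V gP2V).
Local Notation Q1 := (V gQ1).
Local Notation Q2 := (V gQ2).
Local Notation Q2V := (V gQ2V).
Local Notation R := (V gR).

Local Open Scope pres_scope.
Inductive sph_rel : term k sph_gen -> term k sph_gen -> Prop :=
| rel_P2_P2V : sph_rel (P2 * P2V) 1
| rel_P2V_P2 : sph_rel (P2V * P2) 1
| rel_Q2_Q2V : sph_rel (Q2 * Q2V) 1
| rel_Q2V_Q2 : sph_rel (Q2V * Q2) 1
| rel_P2P1 : sph_rel (P2 * P1) (P1 * P2)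
| rel_Q2Q1 : sph_rel (Q2 * Q1) (Q1 * Q2)
| rel_P2Q2 : sph_rel (P2 * Q2) (q ^- 4 *: (Q2 * P2))
| rel_P2Q1 : sph_rel (P2 * Q1) (q ^- 2 *: (Q1 * P2))
| rel_P1Q2 : sph_rel (P1 * Q2) (q ^- 2 *: (Q2 * P1))
| rel_P1Q1 : sph_rel (P1 * Q1) (Q1 * P1 + (q ^- 2 - 1) *: R)
| rel_P2R : sph_rel (P2 * R) (q ^- 2 *: (R * P2))
| rel_RQ2 : sph_rel (R * Q2) (q ^- 2 *: (Q2 * R))
| rel_P1R : sph_rel (P1 * R) (q ^- 2 *: (R * P1) + (1 - q ^- 2) *: (Q1 * P2))
| rel_RQ1 : sph_rel (R * Q1) (q ^- 2 *: (Q1 * R) + (1 - q ^- 2) *: (Q2 * P1))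
| rel_RR : sph_rel (R * R)
    (((1 + t ^+ 2) * (q ^- 2 + t ^- 2)) *: (Q2 * P2)
     - q ^- 2 *: (Q2 * (P1 * P1)) - q ^- 2 *: (Q1 * Q1 * P2)
     + q ^- 2 *: (Q1 * R * P1)).
Local Close Scope pres_scope.

Definition sph_alg := presented sph_rel.
HB.instance Definition _ := PzAlgebra.on sph_alg.

Definition sgen (g : sph_gen) : sph_alg := gen sph_rel g.

(* The integer powers of [x], where [xV] is its inverse. *)
Definition zpow (A : pzRingType) (x xV : A) (n : int) : A :=
  match n with Posz m => x ^+ m | Negz m => xV ^+ m.+1 end.

Definition sph_mon (j : nat * int * bool * nat * int) : sph_alg :=
  let: (a1, a2, eps, b1, b2) := j in
  sgen gQ1 ^+ a1 * zpow (sgen gQ2) (sgen gQ2V) a2 * sgen gR ^+ eps *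
  sgen gP1 ^+ b1 * zpow (sgen gP2) (sgen gP2V) b2.

End SphPresentation.

(* Main.v *)
Require Import Defs.
From HB Require Import structures.
From mathcomp Require Import all_boot all_order all_algebra.
From mathcomp Require Import reals.
From mathcomp Require Import generic_quotient fraction ring zify boolp.

Set Implicit Arguments.
Unset Strict Implicit.
Unset Printing Implicit Defensive.

Import Order.TTheory GRing.Theory Num.Theory.
Local Open Scope ring_scope.

(** Since [e] absorbs [T], the relations of [A] are identities between ordered
    expressions in [Y1, Y2, X1, X2] applied to [e].  These span [H e];
    writing a Laurent polynomial in the [Y]'s as [f + f' Y1], and one in the
    [X]'s as [g + X1 g'], with symmetric [f, f', g, g'], leaves only [e X1 e],
    [e Y1 e] and [e Y1 X1 e] to be checked, so [Phi] is onto.  In [A], the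
    relations move [P1], [P2] and [R] to the right of [Q1] and [Q2], so the
    monomials span.  For their independence, [H] acts on functions on the
    extended affine Weyl group by Demazure-Lusztig operators at a generic point
    [(a, b)].  On symmetric functions, [Q1] and [R] become sums of two shifts,
    the coefficients of [R] being those of [Q1] times [q^2 X1], resp. [q^2 X2].
    The two extremal shifts in a vanishing combination of monomials give
    [S0 + a S1 = 0 = S0 + b S1], where [S0] and [S1] collect the terms with
    [eps = 0, 1]; hence [S0 = S1 = 0], and the powers of [a + b] and [a b] are
    independent. *)

(** * Presentations and linear combinations *)

(** One independence statement serves twice: the monomials span [A] and their images in [e H e] are
    independent, so [Phi] is injective and the images form a basis. To prove it, [k], which may be a
    proper ring, is embedded in a field [L], and [H] acts on functions with values in the fraction
    field of [L[Y][X]], at the point [a = X], [b = Y]. Genericity of this point enters in two ways.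
    No ratio of the two coordinates along the orbit is a scalar; hence the denominators [x2 - x1]
    never vanish, nor do the coefficients [cT] of the extremal shifts, whose only zeros would be at
    [x1 = t^-2 x2]. And the products of powers of [a + b] and [a b] are independent over [L], which
    separates the exponents [b1], [b2]. *)

Section Span.
Variables (k : comNzRingType) (A : pzAlgType k) (J : eqType) (b : J -> A).

(** Indices may repeat, so that a sum of combinations is a concatenation; [spans_uniq] merges
    them. *)
Definition spans (x : A) : Prop :=
  exists l : seq (k * J), x = \sum_(p <- l) algin p.1 * b p.2.

Lemma spans0 : spans 0.
Proof. by exists [::]; rewrite big_nil. Qed.

Lemma spans_gen j : spans (b j).
Proof. by exists [:: (1, j)]; rewrite big_seq1 rmorph1 mul1r. Qed.

Lemma spansD x y : spans x -> spans y -> spans (x + y).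
Proof. by move=> [l ->] [l' ->]; exists (l ++ l'); rewrite big_cat. Qed.

Lemma spansZ c x : spans x -> spans (algin c * x).
Proof.
move=> [l ->]; exists [seq (c * p.1, p.2) | p <- l].
by rewrite big_map mulr_sumr; apply: eq_bigr => p _; rewrite rmorphM mulrA.
Qed.

Lemma spans_mull y : (forall j, spans (y * b j)) ->
  forall x, spans x -> spans (y * x).
Proof.
move=> yb x [l ->]; rewrite mulr_sumr; elim: l => [|p l IH].
  by rewrite big_nil; apply: spans0.
rewrite big_cons; apply: spansD => //.
by rewrite mulrA -algin_comm -mulrA; apply: spansZ.
Qed.

Lemma spans_uniq x : spans x ->
  exists (s : seq J) (c : J -> k),
    uniq s /\ x = \sum_(j <- s) algin (c j) * b j.
Proof.
move=> [l ->]; exists (undup [seq p.2 | p <- l]).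
exists (fun j => \sum_(p <- l | j == p.2) p.1); split; first exact: undup_uniq.
under [RHS]eq_bigr do rewrite rmorph_sum mulr_suml.
rewrite (exchange_big_dep predT) //= big_seq [RHS]big_seq.
apply: eq_bigr => p lp.
rewrite -big_filter (@filter_pred1_uniq _ _ p.2) ?undup_uniq ?big_seq1 //.
by rewrite mem_undup map_f.
Qed.

End Span.

Section Lift.
Variables (k : comNzRingType) (I : Type).
Variable rel : term k I -> term k I -> Prop.
Variables (B : pzAlgType k) (g : I -> B).

Fixpoint teval (x : term k I) : B :=
  match x with
  | Var i => g i
  | Cst c => algin c
  | Add x y => teval x + teval y
  | Mul x y => teval x * teval y
  end.

Definition respects := forall x y, rel x y -> teval x = teval y.

Hypothesis rel_g : respects.

Lemma teval_congr x y : congr rel x y -> teval x = teval y.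
Proof.
elim=> {x y} //=.
- by move=> x y z _ -> _ ->.
- by move=> x x' y y' _ -> _ ->.
- by move=> x x' y y' _ -> _ ->.
- by move=> x y z; rewrite addrA.
- by move=> x y; rewrite addrC.
- by move=> x; rewrite rmorph0 add0r.
- by move=> x y z; rewrite mulrA.
- by move=> x; rewrite rmorph1 mul1r.
- by move=> x; rewrite rmorph0 mul0r.
- by move=> x y z; rewrite mulrDl.
- by move=> x y z; rewrite mulrDr.
- by move=> a b; rewrite rmorphD.
- by move=> a b; rewrite rmorphM.
- by move=> a x; rewrite algin_comm.
Qed.

(** Universal property of a presented algebra. Carrying the proof [h] in the term ties the morphism
    structures below to generators that respect the relations. *)
Definition plift (h : respects) (x : presented rel) : B := teval (repr x).

Lemma plift_cls x : plift rel_g (cls rel x) = teval x.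
Proof. exact/teval_congr/repr_cls. Qed.

Lemma plift_zmod : zmod_morphism (plift rel_g).
Proof.
elim/clsW=> x; elim/clsW=> y.
suff -> : cls rel x - cls rel y = cls rel (x - y)%pres.
  by rewrite !plift_cls /= rmorphN1 mulN1r.
by rewrite cls_add cls_mul cls_cst rmorphN1 mulN1r.
Qed.

Lemma plift_monoid : monoid_morphism (plift rel_g).
Proof.
split; first by apply: etrans (plift_cls _) _; rewrite /= rmorph1.
by elim/clsW=> x; elim/clsW=> y; rewrite -cls_mul !plift_cls.
Qed.

HB.instance Definition _ :=
  GRing.isZmodMorphism.Build (presented rel) B (plift rel_g) plift_zmod.
HB.instance Definition _ :=
  GRing.isMonoidMorphism.Build (presented rel) B (plift rel_g) plift_monoid.

Lemma plift_gen i : plift rel_g (gen rel i) = g i.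
Proof. exact: plift_cls. Qed.

Lemma plift_algin c : plift rel_g (algin c) = algin c.
Proof. by rewrite -cls_cst plift_cls. Qed.

End Lift.

Section LinearCombination.
Variables (k : comNzRingType) (B : pzAlgType k).

(** Words in the generators do not commute, so [ring] cannot treat them in [B]. They are atoms here,
    and only their coefficients in the commutative ring [k] are handed to [ring]. *)
Inductive lexp :=
| LAtom of nat
| LAdd of lexp & lexp
| LOpp of lexp
| LScale of k & lexp.

Fixpoint leval (v : seq B) (l : lexp) : B :=
  match l with
  | LAtom i => v`_i
  | LAdd l l' => leval v l + leval v l'
  | LOpp l => - leval v l
  | LScale c l => algin c * leval v l
  end.

Fixpoint lcoef (l : lexp) (i : nat) : k :=
  match l with
  | LAtom j => if i == j then 1 else 0
  | LAdd l l' => lcoef l i + lcoef l' i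
  | LOpp l => - lcoef l i
  | LScale c l => c * lcoef l i
  end.

Lemma levalE v l :
  leval v l = \sum_(i < size v) algin (lcoef l i) * v`_i.
Proof.
elim: l => /= [j|l -> l' ->|l ->|c l ->].
- have [ltj|lej] := ltnP j (size v); last first.
    rewrite nth_default // big1 // => i _.
    by rewrite ltn_eqF ?rmorph0 ?mul0r // (leq_trans (ltn_ord i)).
  rewrite (bigD1 (Ordinal ltj)) //= eqxx rmorph1 mul1r big1 ?addr0 // => i.
  by rewrite -val_eqE /= => /negbTE ->; rewrite rmorph0 mul0r.
- by rewrite -big_split; apply: eq_bigr => i _; rewrite rmorphD mulrDl.
- by rewrite -sumrN; apply: eq_bigr => i _; rewrite rmorphN mulNr.
- by rewrite mulr_sumr; apply: eq_bigr => i _; rewrite rmorphM mulrA.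
Qed.

Lemma leval_eq v l l' :
  (forall i, (i < size v)%N -> lcoef l i = lcoef l' i) ->
  leval v l = leval v l'.
Proof.
by move=> h; rewrite !levalE; apply: eq_bigr => i _; rewrite h.
Qed.

End LinearCombination.

Ltac lin_index x vs :=
  lazymatch vs with
  | x :: _ => constr:(0%N)
  | _ :: ?vs' => let n := lin_index x vs' in constr:(n.+1)
  end.

Ltac lin_mem x vs :=
  lazymatch vs with
  | [::] => constr:(false)
  | x :: _ => constr:(true)
  | _ :: ?vs' => lin_mem x vs'
  end.

Ltac lin_atoms vs x :=
  lazymatch x with
  | ?a + ?b => let vs' := lin_atoms vs a in lin_atoms vs' b
  | - ?a => lin_atoms vs a
  | algin ?c * ?a => lin_atoms vs a
  | _ => let m := lin_mem x vs in
         lazymatch m with true => vs | false => constr:(x :: vs) end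
  end.

Ltac lin_reify k vs x :=
  lazymatch x with
  | ?a + ?b => let a' := lin_reify k vs a in
               let b' := lin_reify k vs b in constr:(LAdd a' b')
  | - ?a => let a' := lin_reify k vs a in constr:(LOpp a')
  | algin ?c * ?a => let a' := lin_reify k vs a in constr:(LScale c a')
  | _ => let i := lin_index x vs in constr:(@LAtom k i)
  end.

(* Reduces an equality of linear combinations to the equalities of the
   coefficients of each atom. *)
Ltac lin_split :=
  lazymatch goal with
  | |- @eq ?B ?x ?y =>
    let vs := lin_atoms (@nil B) x in
    let vs := lin_atoms vs y in
    let k := lazymatch goal with |- context [@algin ?k _ _] => k end in
    let lx := lin_reify k vs x in
    let ly := lin_reify k vs y in
    apply: (leval_eq (v := vs) (l := lx) (l' := ly));
    let i := fresh in
    move=> i; do ?[case: i => [_ /=|i //]]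
  end.

(** * The relations of [A] in the spherical subalgebra *)

(** Orients [w (1 + t^2) = 1] into equations with a monomial on the left, which [ring] can use as
    rewriting rules. *)
Lemma mul_inv_sqr (k : comNzRingType) (t u w : k) :
  t * u = 1 -> w * (1 + t ^+ 2) = 1 ->
  w * t ^+ 2 = 1 - w /\ w * (u * u) = u * u - w.
Proof.
move=> tu ws; split; first by rewrite -[1 in RHS]ws; ring.
by rewrite -[u * u in RHS]mulr1 -[1 in RHS]ws; ring: tu.
Qed.

Section DahaRelations.
Variables (k : comUnitRingType) (t q : k).
Hypotheses (ht : t \is a GRing.unit) (hq : q \is a GRing.unit).
Hypothesis (hs : t ^+ 2 + 1 \is a GRing.unit).

Variables (H : pzAlgType k) (g : daha_gen -> H).
Hypothesis rel_g : respects (daha_rel t q) g.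

Local Notation T := (g gT).
Local Notation V := (g gTV).
Local Notation X1 := (g gX1).
Local Notation X1V := (g gX1V).
Local Notation X2 := (g gX2).
Local Notation X2V := (g gX2V).
Local Notation Y1 := (g gY1).
Local Notation Y1V := (g gY1V).
Local Notation Y2 := (g gY2).
Local Notation Y2V := (g gY2V).
Local Notation u := (t^-1).
Local Notation v := (q ^- 2).

Lemma dT_TV : T * V = 1 :> H.
Proof. by have /= := rel_g (rel_T_TV t q); rewrite ?rmorph1. Qed.
Lemma dTV_T : V * T = 1 :> H.
Proof. by have /= := rel_g (rel_TV_T t q); rewrite ?rmorph1. Qed.
Lemma dX1_X1V : X1 * X1V = 1 :> H.
Proof. by have /= := rel_g (rel_X1_X1V t q); rewrite ?rmorph1. Qed.
Lemma dX1V_X1 : X1V * X1 = 1 :> H.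
Proof. by have /= := rel_g (rel_X1V_X1 t q); rewrite ?rmorph1. Qed.
Lemma dX2_X2V : X2 * X2V = 1 :> H.
Proof. by have /= := rel_g (rel_X2_X2V t q); rewrite ?rmorph1. Qed.
Lemma dX2V_X2 : X2V * X2 = 1 :> H.
Proof. by have /= := rel_g (rel_X2V_X2 t q); rewrite ?rmorph1. Qed.
Lemma dY1_Y1V : Y1 * Y1V = 1 :> H.
Proof. by have /= := rel_g (rel_Y1_Y1V t q); rewrite ?rmorph1. Qed.
Lemma dY1V_Y1 : Y1V * Y1 = 1 :> H.
Proof. by have /= := rel_g (rel_Y1V_Y1 t q); rewrite ?rmorph1. Qed.
Lemma dY2_Y2V : Y2 * Y2V = 1 :> H.
Proof. by have /= := rel_g (rel_Y2_Y2V t q); rewrite ?rmorph1. Qed.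
Lemma dY2V_Y2 : Y2V * Y2 = 1 :> H.
Proof. by have /= := rel_g (rel_Y2V_Y2 t q); rewrite ?rmorph1. Qed.
Lemma dTXT : T * X1 * T = X2 :> H.
Proof. by have /= := rel_g (rel_TXT t q); rewrite ?rmorph1. Qed.
Lemma dTYT : V * Y1 * V = Y2 :> H.
Proof. by have /= := rel_g (rel_TYT t q); rewrite ?rmorph1. Qed.
Lemma dXX : X1 * X2 = X2 * X1 :> H.
Proof. by have /= := rel_g (rel_XX t q); rewrite ?rmorph1. Qed.
Lemma dYY : Y1 * Y2 = Y2 * Y1 :> H.
Proof. by have /= := rel_g (rel_YY t q); rewrite ?rmorph1. Qed.
Lemma dYXX : Y1 * X1 * X2 = algin (q ^+ 2) * (X1 * X2 * Y1) :> H.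
Proof. by have /= := rel_g (rel_YXX t q); rewrite ?rmorph1. Qed.
Lemma dXY : X1V * Y2 = Y2 * X1V * (V * V) :> H.
Proof. by have /= := rel_g (rel_XY t q); rewrite ?rmorph1. Qed.
Lemma dquad : (T + algin u) * (T - algin t) = 0 :> H.
Proof.
by have /= := rel_g (rel_quad t q); rewrite rmorph0 rmorphN1 mulN1r.
Qed.


Local Notation h := (t - u).

Lemma dalgin_unit (c : k) (z : H) : c \is a GRing.unit ->
  algin c^-1 * (algin c * z) = z.
Proof. by move=> uc; rewrite mulrA -rmorphM mulVr // rmorph1 mul1r. Qed.

Lemma mulrCA_scal (c : k) (x y : H) :
  algin c * (x * y) = x * (algin c * y).
Proof. by rewrite !mulrA algin_comm. Qed.

(** This rule and the following ones carry a tail [z]: on right-associated words they then apply at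
    any position. *)
Lemma dTT (z : H) : T * (T * z) = algin h * (T * z) + z.
Proof.
have := congr1 ( *%R^~ z) dquad.
rewrite mul0r -mulrA mulrBl mulrDl mulrBr -[T * (algin t * z)]mulrCA_scal.
rewrite mulrBr dalgin_unit // => /eqP; rewrite addr_eq0 => /eqP E.
rewrite -[LHS](subrK (algin t * (T * z))) E rmorphB mulrBl.
by rewrite opprB addrC addrA addrAC.
Qed.

Lemma mulVK (x xV z : H) : x * xV = 1 -> x * (xV * z) = z.
Proof. by move=> xx; rewrite mulrA xx mul1r. Qed.

Lemma dTV (z : H) : T * (V * z) = z.
Proof. by rewrite mulrA dT_TV mul1r. Qed.

Lemma dVT (z : H) : V * (T * z) = z.
Proof. by rewrite mulrA dTV_T mul1r. Qed.

Lemma dTE (z : H) : T * z = algin h * z + V * z.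
Proof.
by rewrite -[T * z in LHS]dVT dTT mulrDr -mulrCA_scal dVT.
Qed.

Lemma dVE (z : H) : V * z = T * z - algin h * z.
Proof. by rewrite dTE addrAC subrr add0r. Qed.

Lemma dTX1 (z : H) : T * (X1 * z) = X2 * (V * z).
Proof. by rewrite -dTXT -!mulrA dTV. Qed.

Lemma dVX2 (z : H) : V * (X2 * z) = X1 * (T * z).
Proof. by rewrite -dTXT -!mulrA dVT. Qed.

Lemma dTY2 (z : H) : T * (Y2 * z) = Y1 * (V * z).
Proof. by rewrite -dTYT -!mulrA dTV. Qed.

Lemma dVY1 (z : H) : V * (Y1 * z) = Y2 * (T * z).
Proof. by rewrite -dTYT -!mulrA dVT. Qed.

Lemma dXXC (z : H) : X2 * (X1 * z) = X1 * (X2 * z).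
Proof. by rewrite mulrA -dXX mulrA. Qed.

Lemma dYYC (z : H) : Y2 * (Y1 * z) = Y1 * (Y2 * z).
Proof. by rewrite mulrA -dYY mulrA. Qed.

(** The cross relation, read as [X1 Y2 X1^-1 = Y2 T^2]. *)
Lemma dX1Y2_aux (z : H) : X1 * (Y2 * z) = Y2 * (T * (T * (X1 * z))).
Proof.
have E : X1 * (Y2 * X1V) = Y2 * (T * T).
  have := congr1 (fun x => X1 * (x * (T * T))) dXY; rewrite -!mulrA.
  by rewrite dVT dTV_T mulr1 [LHS]mulrA dX1_X1V mul1r => ->.
have := congr1 ( *%R^~ (X1 * z)) E; rewrite -!mulrA => <-.
by rewrite [X1V * _]mulrA dX1V_X1 mul1r.
Qed.

Lemma dX1Y2 (z : H) :
  X1 * (Y2 * z) = Y2 * (X1 * z) + algin h * (Y2 * (X2 * (V * z))).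
Proof. by rewrite dX1Y2_aux dTT mulrDr dTX1 addrC -mulrCA_scal. Qed.

Lemma dY1X2 (z : H) : Y1 * (X2 * z) = X2 * (V * (V * (Y1 * z))).
Proof.
rewrite -[Y1 * (X2 * z)]dTV dVY1 -[X2 * z in LHS]dTV dVX2.
by rewrite -dX1Y2_aux dTX1 dVY1.
Qed.

(** [Y1] passes [X1 X2] up to [q^2] and passes [X2] by [dY1X2]; cancelling [X2] leaves its passage
    across [X1]. *)
Lemma dX1Y1_aux (z : H) : X1 * (Y1 * z) = algin v * (V * (V * (Y1 * (X1 * z)))).
Proof.
have E : X2 * (algin (q ^+ 2) * (X1 * (Y1 * z))) =
         X2 * (V * (V * (Y1 * (X1 * z)))).
  rewrite -dY1X2 dXXC -mulrCA_scal dXXC.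
  by have := congr1 ( *%R^~ z) dYXX; rewrite -!mulrA => <-.
have := congr1 ( *%R X2V) E; rewrite !mulrA dX2V_X2 !mul1r -!mulrA => <-.
by rewrite dalgin_unit // unitrX.
Qed.

Lemma dVX1 (z : H) : V * (X1 * z) = X2 * (V * z) - algin h * (X1 * z).
Proof. by rewrite dVE dTX1. Qed.

Lemma dTX2 (z : H) : T * (X2 * z) = X1 * (T * z) + algin h * (X2 * z).
Proof. by rewrite dTE dVX2 addrC. Qed.

Lemma dVY2 (z : H) : V * (Y2 * z) = Y1 * (V * z) - algin h * (Y2 * z).
Proof. by rewrite dVE dTY2. Qed.

Lemma dTY1 (z : H) : T * (Y1 * z) = Y2 * (T * z) + algin h * (Y1 * z).
Proof. by rewrite dTE dVY1 addrC. Qed.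

Lemma dVV (z : H) : V * (V * z) = z - algin h * (V * z).
Proof. by rewrite {1}dVE dTV. Qed.

Lemma dX1Y1 (z : H) :
  X1 * (Y1 * z) = algin v * (Y1 * (X1 * z) - algin h * (Y2 * (X2 * (V * z)))).
Proof.
rewrite dX1Y1_aux dVY1 dVY2 dTX1; congr (_ * (_ - _)).
by rewrite -dTX1 dVT.
Qed.

(* Ring laws restated for [H]: [lin_split] compares atoms syntactically, so all
   products must carry the same path to the ring structure. *)
Lemma dmulrDr (x y z : H) : x * (y + z) = x * y + x * z.
Proof. exact: mulrDr. Qed.
Lemma dmulrN (x y : H) : x * - y = - (x * y).
Proof. exact: mulrN. Qed.
Lemma dmulrDl (x y z : H) : (x + y) * z = x * z + y * z.
Proof. exact: mulrDl. Qed.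
Lemma dmulA (x y z : H) : x * y * z = x * (y * z).
Proof. by rewrite mulrA. Qed.

Lemma scalT c (z : H) : T * (algin c * z) = algin c * (T * z).
Proof. by rewrite mulrCA_scal. Qed.
Lemma scalV c (z : H) : V * (algin c * z) = algin c * (V * z).
Proof. by rewrite mulrCA_scal. Qed.
Lemma scalX1 c (z : H) : X1 * (algin c * z) = algin c * (X1 * z).
Proof. by rewrite mulrCA_scal. Qed.
Lemma scalX2 c (z : H) : X2 * (algin c * z) = algin c * (X2 * z).
Proof. by rewrite mulrCA_scal. Qed.
Lemma scalY1 c (z : H) : Y1 * (algin c * z) = algin c * (Y1 * z).
Proof. by rewrite mulrCA_scal. Qed.
Lemma scalY2 c (z : H) : Y2 * (algin c * z) = algin c * (Y2 * z).
Proof. by rewrite mulrCA_scal. Qed.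
Definition scalE := (scalT, scalV, scalX1, scalX2, scalY1, scalY2).
Definition linE := (dmulrDr, dmulrDl, dmulA, dmulrN, scalE).
Definition TVE := (dTT, dTV, dVT, dVV, dTX1, dTX2, dVX1, dVX2, dTY1, dTY2,
  dVY1, dVY2, dXXC, dYYC).

Let tu : t * u = 1. Proof. by rewrite mulrV. Qed.

Lemma dX2Y1 (z : H) :
  X2 * (Y1 * z) = Y1 * (X2 * z) + algin (h * v) * (Y2 * (X2 * (V * z))).
Proof.
rewrite -[X2 * (Y1 * z)]dTV dVX2 dTY1 !linE dX1Y2 dX1Y1.
(* Each pass pushes [T] and [V] towards the tail and trades the remaining [T] for [V], until both
   sides are combinations of the same ordered words. *)
do 5! rewrite ?(linE, TVE) ?dTE.
lin_split; ring: tu.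
Qed.

Lemma dX2Y2 (z : H) :
  X2 * (Y2 * z) = algin v * (Y2 * (X2 * (V * (V * z)))).
Proof.
rewrite -[X2 * (Y2 * z)]dTV dVX2 dTY2 dX1Y1.
do 5! rewrite ?(linE, TVE) ?dTE.
lin_split; ring: tu.
Qed.

Lemma dp2Y1 (z : H) : X1 * (X2 * (Y1 * z)) = algin v * (Y1 * (X1 * (X2 * z))).
Proof.
do 9! rewrite ?(dX1Y1, dX1Y2, dX2Y1, dX2Y2, TVE, linE) ?dTE.
lin_split; ring: tu.
Qed.

Lemma dp2Y2 (z : H) : X1 * (X2 * (Y2 * z)) = algin v * (Y2 * (X1 * (X2 * z))).
Proof.
do 9! rewrite ?(dX1Y1, dX1Y2, dX2Y1, dX2Y2, TVE, linE) ?dTE.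
lin_split; ring: tu.
Qed.

Variable e : H.
Hypothesis eE : e = algin (1 + t ^+ 2)^-1 * (1 + algin t * T).
Local Notation w := ((1 + t ^+ 2)^-1).
Let ws : w * (1 + t ^+ 2) = 1. Proof. by rewrite mulVr // addrC. Qed.

Lemma sph_eM (z : H) : e * z = algin w * (z + algin t * (T * z)).
Proof. by rewrite eE -mulrA mulrDl mul1r -mulrA. Qed.

Lemma sph_eMr (z : H) : z * e = algin w * (z + algin t * (z * T)).
Proof. by rewrite eE -mulrCA_scal mulrDr mulr1 -mulrCA_scal. Qed.

Lemma dTe : T * e = algin t * e.
Proof.
rewrite -[e]mulr1 sph_eM !(dmulrDr, scalE) dTT //.
lin_split; ring: tu.
Qed.

Lemma dVe : V * e = algin u * e.
Proof. by rewrite dVE // dTe -mulrBl -rmorphB opprB addrC subrK. Qed.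

Lemma sph_e_comm (x : H) : T * x = x * T -> e * x = x * e.
Proof. by move=> Tx; rewrite sph_eM sph_eMr Tx. Qed.

Lemma comm_inv (A : pzRingType) (a x xV : A) :
  x * xV = 1 -> xV * x = 1 -> a * x = x * a -> a * xV = xV * a.
Proof.
move=> xxV xVx ax.
by rewrite -[a * xV]mul1r -xVx -!mulrA [x * _]mulrA -ax -mulrA xxV mulr1.
Qed.

Lemma dTp1 : T * (X1 + X2) = (X1 + X2) * T :> H.
Proof.
rewrite -[LHS]mulr1 -mulrA mulrDl !(dmulrDr, dTX1, dTX2) mulrDl.
by rewrite !mulr1 [X2 * V + _]addrC -addrA; congr (_ + _);
   rewrite -[T in RHS]mulr1 dTE // !(dmulrDr, scalE) !mulr1.
Qed.

Lemma dTp2 : T * (X1 * X2) = X1 * X2 * T :> H.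
Proof. by rewrite dTX1 -{2}dTXT -!mulrA dVT !mulrA dXX. Qed.

Lemma dTq1 : T * (Y1 + Y2) = (Y1 + Y2) * T :> H.
Proof.
rewrite -[LHS]mulr1 -mulrA mulrDl !(dmulrDr, dTY2, dTY1) mulrDl.
rewrite !mulr1 -addrA addrC; congr (_ + _).
by rewrite -[T in RHS]mulr1 dTE // !(dmulrDr, scalE) !mulr1.
Qed.


Lemma dTq2 : T * (Y1 * Y2) = Y1 * Y2 * T :> H.
Proof.
rewrite {1}dYY dTY2 -[RHS]mulrA; congr (_ * _).
by rewrite -dTYT -mulrA dTV_T mulr1.
Qed.

(** The hypothesis holds for [e] and for every element of the corner, so [R] can be evaluated
    without its outer [e] inside products as well. *)
Lemma dR_fixed (z : H) : T * z = algin t * z ->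
  e * ((algin (t ^- 2) * Y1 * X1 + Y2 * X2) * z) =
  Y1 * (X1 * z) + algin (u * u) * (Y2 * (X2 * z)).
Proof.
have tu2 : t ^- 2 = u * u by rewrite -exprVn expr2.
move=> Tz; have Vz : V * z = algin u * z.
  by rewrite dVE // Tz -mulrBl -rmorphB opprB addrC subrK.
rewrite sph_eM tu2 !linE !TVE // !linE Vz Tz !linE.
have [wt wu] := mul_inv_sqr tu ws.
lin_split; first by ring: tu wu.
by transitivity (w * t ^+ 2 + w); [ring: tu | rewrite wt; ring].
Qed.

Variable pe : e * e = e.
Let i := Idempotent pe.
Local Notation C := (corner i).
Local Notation cor x := (corner_in i x : C).

Lemma corner_invE (x : H) : T * x = x * T -> val (cor x) = x * e.
Proof. by move=> Tx; rewrite /= sph_e_comm // -mulrA pe. Qed.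

Lemma corner_invM (x : H) (y : C) :
  T * x = x * T -> val (cor x * y) = x * val y.
Proof.
move=> Tx; rewrite -[LHS]/(e * x * e * val y) -(mulrA (e * x)).
by rewrite (corner_mull y) sph_e_comm // -mulrA (corner_mull y).
Qed.

Lemma cornerDE (x y : C) : val (x + y) = val x + val y.
Proof. by []. Qed.

Lemma cornerZE c (x : C) : val (algin c * x) = algin c * val x.
Proof.
rewrite -[LHS]/(e * algin c * e * val x) -(mulrA (e * _)) (corner_mull x).
by rewrite -algin_comm -mulrA (corner_mull x).
Qed.

Lemma corner1E : val (1 : C) = e.
Proof. by []. Qed.

Local Notation cR := (cor (algin (t ^- 2) * Y1 * X1 + Y2 * X2)).

Lemma dT_corner (y : C) : T * val y = algin t * val y.
Proof.
have E : e * val y = val y := corner_mull y.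
by rewrite -E -dmulA dTe dmulA.
Qed.

Lemma cornerRM (y : C) :
  val (cR * y) = Y1 * (X1 * val y) + algin (u * u) * (Y2 * (X2 * val y)).
Proof.
rewrite -[LHS]/(e * _ * e * val y) -(mulrA (e * _)) (corner_mull y) -mulrA.
exact/dR_fixed/dT_corner.
Qed.

Lemma cornerRE : val cR = Y1 * (X1 * e) + algin (u * u) * (Y2 * (X2 * e)).
Proof. by rewrite -[in LHS](mulr1 cR) cornerRM. Qed.

Definition sph_img (s : sph_gen) : C :=
  match s with
  | gP1 => cor (X1 + X2)
  | gP2 => cor (X1 * X2)
  | gP2V => cor (X2V * X1V)
  | gQ1 => cor (Y1 + Y2)
  | gQ2 => cor (Y1 * Y2)
  | gQ2V => cor (Y2V * Y1V)
  | gR => cR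
  end.

Arguments sph_img : simpl never.

Lemma mul_inv2 (A : pzRingType) (x xV y yV : A) :
  x * xV = 1 -> y * yV = 1 -> x * y * (yV * xV) = 1.
Proof. by move=> xx yy; rewrite -mulrA [y * _]mulrA yy mul1r. Qed.

Lemma dTp2V : T * (X2V * X1V) = X2V * X1V * T :> H.
Proof.
apply: comm_inv dTp2; apply: mul_inv2;
  by rewrite ?dX1_X1V ?dX2_X2V ?dX1V_X1 ?dX2V_X2.
Qed.

Lemma dTq2V : T * (Y2V * Y1V) = Y2V * Y1V * T :> H.
Proof.
apply: comm_inv dTq2; apply: mul_inv2;
  by rewrite ?dY1_Y1V ?dY2_Y2V ?dY1V_Y1 ?dY2V_Y2.
Qed.

(** A product in the corner is unfolded from the left: the [M] form removes a leading factor, the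
    [E] form treats the last one. *)
Let P1M y : val (sph_img gP1 * y) = X1 * val y + X2 * val y.
Proof. by rewrite corner_invM ?dTp1 // mulrDl. Qed.
Let P1E : val (sph_img gP1) = X1 * e + X2 * e.
Proof. by rewrite corner_invE ?dTp1 // mulrDl. Qed.
Let P2M y : val (sph_img gP2 * y) = X1 * (X2 * val y).
Proof. by rewrite corner_invM ?dTp2 // -mulrA. Qed.
Let P2E : val (sph_img gP2) = X1 * (X2 * e).
Proof. by rewrite corner_invE ?dTp2 // -mulrA. Qed.
Let P2VM y : val (sph_img gP2V * y) = X2V * (X1V * val y).
Proof. by rewrite corner_invM ?dTp2V // -mulrA. Qed.
Let P2VE : val (sph_img gP2V) = X2V * (X1V * e).
Proof. by rewrite corner_invE ?dTp2V // -mulrA. Qed.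
Let Q1M y : val (sph_img gQ1 * y) = Y1 * val y + Y2 * val y.
Proof. by rewrite corner_invM ?dTq1 // mulrDl. Qed.
Let Q1E : val (sph_img gQ1) = Y1 * e + Y2 * e.
Proof. by rewrite corner_invE ?dTq1 // mulrDl. Qed.
Let Q2M y : val (sph_img gQ2 * y) = Y1 * (Y2 * val y).
Proof. by rewrite corner_invM ?dTq2 // -mulrA. Qed.
Let Q2E : val (sph_img gQ2) = Y1 * (Y2 * e).
Proof. by rewrite corner_invE ?dTq2 // -mulrA. Qed.
Let Q2VM y : val (sph_img gQ2V * y) = Y2V * (Y1V * val y).
Proof. by rewrite corner_invM ?dTq2V // -mulrA. Qed.
Let Q2VE : val (sph_img gQ2V) = Y2V * (Y1V * e).
Proof. by rewrite corner_invE ?dTq2V // -mulrA. Qed.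
Let RM y : val (sph_img gR * y) =
  Y1 * (X1 * val y) + algin (u * u) * (Y2 * (X2 * val y)).
Proof. exact: cornerRM. Qed.
Let RE : val (sph_img gR) = Y1 * (X1 * e) + algin (u * u) * (Y2 * (X2 * e)).
Proof. exact: cornerRE. Qed.

Let imgE := (P1M, P2M, P2VM, Q1M, Q2M, Q2VM, RM,
  P1E, P2E, P2VE, Q1E, Q2E, Q2VE, RE, cornerDE, cornerZE, corner1E).

Lemma sph_img_rel : respects (sph_rel t q) sph_img.
Proof.
have v2 : q ^- 4 = v * v by rewrite -!exprVn -exprD.
have u2 : t ^- 2 = u * u by rewrite -exprVn expr2.
move=> x y; case=> /=; apply: val_inj; rewrite ?rmorph1 -?mulrA ?imgE ?v2 ?u2;
  (* Apart from the four invertibility relations, [e] matters from here on only as an eigenvector of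
     [T] and [V]. *)
  move: dTe dVe; generalize e => z Tz Vz.
5-15: by do 9! rewrite ?(dX1Y1, dX1Y2, dX2Y1, dX2Y2, TVE, linE, Tz, Vz) //;
  lin_split; ring: tu.
- by rewrite (mulVK _ dX2_X2V) (mulVK _ dX1_X1V).
- by rewrite (mulVK _ dX1V_X1) (mulVK _ dX2V_X2).
- by rewrite (mulVK _ dY2_Y2V) (mulVK _ dY1_Y1V).
- by rewrite (mulVK _ dY1V_Y1) (mulVK _ dY2V_Y2).
Qed.

(* [e Y1 X1 e = e Y2 X2 e] and [e] fixes [(t^2 Y1 X1 + Y2 X2) e]; this turns
   [e (t^-2 Y1 X1 + Y2 X2) e] into the value at [gR]. *)
Definition sph_rep (s : sph_gen) : H :=
  match s with
  | gP1 => X1 + X2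
  | gP2 => X1 * X2
  | gP2V => X2V * X1V
  | gQ1 => Y1 + Y2
  | gQ2 => Y1 * Y2
  | gQ2V => Y2V * Y1V
  | gR => Y1 * X1 + algin (u * u) * (Y2 * X2)
  end.

Lemma sph_imgE s : val (sph_img s) = sph_rep s * e.
Proof.
case: s; try by apply: corner_invE;
  rewrite ?dTp1 ?dTp2 ?dTp2V ?dTq1 ?dTq2 ?dTq2V.
by rewrite RE /sph_rep !dmulrDl !dmulA.
Qed.

(** * Generation of the spherical subalgebra *)

(** The letters enter in a fixed order, [X] next to [e] and [Y] in front, so that stability under a
    further letter is an induction on the word. [YXSpan] turns out to be stable under all of
    [teval g]. *)
Inductive XSpan : H -> Prop :=
| XSpan_e : XSpan e
| XSpanD x y : XSpan x -> XSpan y -> XSpan (x + y)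
| XSpanZ c x : XSpan x -> XSpan (algin c * x)
| XSpanX1 x : XSpan x -> XSpan (X1 * x)
| XSpanX2 x : XSpan x -> XSpan (X2 * x)
| XSpanX1V x : XSpan x -> XSpan (X1V * x)
| XSpanX2V x : XSpan x -> XSpan (X2V * x).

Inductive YXSpan : H -> Prop :=
| YXSpan_X x : XSpan x -> YXSpan x
| YXSpanD x y : YXSpan x -> YXSpan y -> YXSpan (x + y)
| YXSpanZ c x : YXSpan x -> YXSpan (algin c * x)
| YXSpanY1 x : YXSpan x -> YXSpan (Y1 * x)
| YXSpanY2 x : YXSpan x -> YXSpan (Y2 * x)
| YXSpanY1V x : YXSpan x -> YXSpan (Y1V * x)
| YXSpanY2V x : YXSpan x -> YXSpan (Y2V * x).

Lemma dX2VE : X2V = V * X1V * V.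
Proof.
by rewrite -[RHS]mul1r -dX2V_X2 -dTXT -!mulrA dTV (mulVK _ dX1_X1V) dT_TV mulr1.
Qed.

Lemma dY2VE : Y2V = T * Y1V * T.
Proof.
by rewrite -[RHS]mul1r -dY2V_Y2 -dTYT -!mulrA dVT (mulVK _ dY1_Y1V) dTV_T mulr1.
Qed.

Lemma dTX2V z : T * (X2V * z) = X1V * (V * z).
Proof. by rewrite dX2VE -!mulrA dTV. Qed.

Lemma dVX1V z : V * (X1V * z) = X2V * (T * z).
Proof. by rewrite dX2VE -!mulrA dVT. Qed.

Lemma dTY1V z : T * (Y1V * z) = Y2V * (V * z).
Proof. by rewrite dY2VE -!mulrA dTV. Qed.

Lemma dVY2V z : V * (Y2V * z) = Y1V * (T * z).
Proof. by rewrite dY2VE -!mulrA dVT. Qed.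

Lemma XSpanN c x y : XSpan x -> XSpan y -> XSpan (x - algin c * y).
Proof.
by move=> Sx Sy; rewrite -mulNr -rmorphN; apply/XSpanD/XSpanZ.
Qed.

(** [T] and [V] are treated together because passing one of them across a letter may produce the
    other. *)
Lemma XSpan_TV x : XSpan x -> XSpan (T * x) /\ XSpan (V * x).
Proof.
elim=> {x}.
- by rewrite dTe dVe; split; apply/XSpanZ/XSpan_e.
- by move=> x y _ [? ?] _ [? ?]; rewrite !mulrDr; split; apply: XSpanD.
- by move=> c x _ [? ?]; rewrite -!mulrCA_scal; split; apply: XSpanZ.
- move=> x Sx [ST SV]; rewrite dTX1 dVX1.
  by split; [|apply: XSpanN]; constructor.
- move=> x Sx [ST SV]; rewrite dTX2 dVX2.
  by split; [apply/XSpanD; last apply: XSpanZ|]; constructor.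
- move=> x Sx [ST SV]; rewrite dTE dVX1V.
  by split; [apply: XSpanD; first apply: XSpanZ|]; constructor.
- move=> x Sx [ST SV]; rewrite dVE dTX2V.
  by split; [|apply: XSpanN]; constructor.
Qed.

Lemma YXSpanN c x y : YXSpan x -> YXSpan y -> YXSpan (x - algin c * y).
Proof.
by move=> Sx Sy; rewrite -mulNr -rmorphN; apply/YXSpanD/YXSpanZ.
Qed.

Lemma YXSpan_TV x : YXSpan x -> YXSpan (T * x) /\ YXSpan (V * x).
Proof.
elim=> {x}.
- by move=> x /XSpan_TV[? ?]; split; apply: YXSpan_X.
- by move=> x y _ [? ?] _ [? ?]; rewrite !mulrDr; split; apply: YXSpanD.
- by move=> c x _ [? ?]; rewrite -!mulrCA_scal; split; apply: YXSpanZ.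
- move=> x Sx [ST SV]; rewrite dTY1 dVY1.
  by split; [apply/YXSpanD; last apply: YXSpanZ|]; constructor.
- move=> x Sx [ST SV]; rewrite dTY2 dVY2.
  by split; [|apply: YXSpanN]; constructor.
- move=> x Sx [ST SV]; rewrite dVE dTY1V.
  by split; [|apply: YXSpanN]; constructor.
- move=> x Sx [ST SV]; rewrite dTE dVY2V.
  by split; [apply: YXSpanD; first apply: YXSpanZ|]; constructor.
Qed.

Lemma YXSpan_T x : YXSpan x -> YXSpan (T * x).
Proof. by case/YXSpan_TV. Qed.

Lemma YXSpan_V x : YXSpan x -> YXSpan (V * x).
Proof. by case/YXSpan_TV. Qed.

Lemma dX1Y1V z : X1 * (Y1V * z) = algin (q ^+ 2) * (Y1V * (T * (T * (X1 * z)))).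
Proof.
rewrite -{2}[z](mulVK _ dY1_Y1V) dX1Y1_aux !scalT !dTV.
rewrite -[Y1V * (algin _ * _)]mulrCA_scal (mulVK _ dY1V_Y1) [RHS]mulrA.
rewrite -rmorphM mulrV ?rmorph1 ?mul1r //.
exact: unitrX.
Qed.

Lemma dX1Y2V z : X1 * (Y2V * z) = V * (V * (Y2V * (X1 * z))).
Proof.
by rewrite -{2}[z](mulVK _ dY2_Y2V) dX1Y2_aux (mulVK _ dY2V_Y2) !dVT.
Qed.

(* Each letter [Y] moves to the left of [X1] at the cost of factors [T], which
   also land on the left of [X1]; this does not hold for [X1^-1]. *)
Lemma YXSpan_X1 x : YXSpan x -> YXSpan (X1 * x).
Proof.
elim=> {x}.
- by move=> x Sx; apply/YXSpan_X/XSpanX1.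
- by move=> x y _ ? _ ?; rewrite mulrDr; apply: YXSpanD.
- by move=> c x _ ?; rewrite -mulrCA_scal; apply: YXSpanZ.
- by move=> x _ Sx; rewrite dX1Y1_aux; apply/YXSpanZ/YXSpan_V/YXSpan_V/YXSpanY1.
- by move=> x _ Sx; rewrite dX1Y2_aux; apply/YXSpanY2/YXSpan_T/YXSpan_T.
- by move=> x _ Sx; rewrite dX1Y1V; apply/YXSpanZ/YXSpanY1V/YXSpan_T/YXSpan_T.
- by move=> x _ Sx; rewrite dX1Y2V; apply/YXSpan_V/YXSpan_V/YXSpanY2V.
Qed.

Lemma YXSpan_X2 x : YXSpan x -> YXSpan (X2 * x).
Proof.
by move=> Sx; rewrite -dTXT -!mulrA; apply/YXSpan_T/YXSpan_X1/YXSpan_T.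
Qed.

Lemma p2_conj (y yV : H) c : c \is a GRing.unit -> y * yV = 1 -> yV * y = 1 ->
  (forall z, X1 * (X2 * (y * z)) = algin c * (y * (X1 * (X2 * z)))) ->
  forall z,
  X2V * (X1V * (y * z)) = algin c^-1 * (y * (X2V * (X1V * z))) /\
  X2V * (X1V * (yV * z)) = algin c * (yV * (X2V * (X1V * z))).
Proof.
move=> uc yyV yVy p2y z.
have E x : X2V * (X1V * (y * x)) = algin c^-1 * (y * (X2V * (X1V * x))).
  rewrite -{1}[x](mulVK _ dX1_X1V) -{1}[X1V * x](mulVK _ dX2_X2V).
  rewrite -[y * (X1 * _)](dalgin_unit _ uc).
  rewrite -p2y -[X1V * (algin _ * _)]mulrCA_scal.
  rewrite -[X2V * (algin _ * _)]mulrCA_scal.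
  by rewrite (mulVK _ dX1V_X1) (mulVK _ dX2V_X2).
split=> //; apply: esym; rewrite -{1}[z](mulVK _ yyV) E.
rewrite -[yV * (algin _ * _)]mulrCA_scal.
by rewrite (mulVK _ yVy) -{1}[c]invrK dalgin_unit ?unitrV.
Qed.

(** [X1 X2] commutes with the [Y] letters up to powers of [q], hence so does its inverse, and no [T]
    appears. Then [X1^-1 = X2 (X1 X2)^-1] gives the letter that could not be moved directly. *)
Lemma YXSpan_p2V x : YXSpan x -> YXSpan (X2V * (X1V * x)).
Proof.
have uv : v \is a GRing.unit by rewrite unitrV unitrX.
have p2Y1 := p2_conj uv dY1_Y1V dY1V_Y1 dp2Y1.
have p2Y2 := p2_conj uv dY2_Y2V dY2V_Y2 dp2Y2.
elim=> {x}.
- by move=> x Sx; apply/YXSpan_X/XSpanX2V/XSpanX1V.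
- by move=> x y _ ? _ ?; rewrite !mulrDr; apply: YXSpanD.
- by move=> c x _ ?; rewrite -!mulrCA_scal; apply: YXSpanZ.
- by move=> x _ Sx; rewrite (p2Y1 x).1; apply/YXSpanZ/YXSpanY1.
- by move=> x _ Sx; rewrite (p2Y2 x).1; apply/YXSpanZ/YXSpanY2.
- by move=> x _ Sx; rewrite (p2Y1 x).2; apply/YXSpanZ/YXSpanY1V.
- by move=> x _ Sx; rewrite (p2Y2 x).2; apply/YXSpanZ/YXSpanY2V.
Qed.

Lemma YXSpan_X1V x : YXSpan x -> YXSpan (X1V * x).
Proof.
by move=> /YXSpan_p2V/YXSpan_X2; rewrite (mulVK _ dX2_X2V).
Qed.

Lemma YXSpan_X2V x : YXSpan x -> YXSpan (X2V * x).
Proof.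
by move=> Sx; rewrite dX2VE -!mulrA; apply/YXSpan_V/YXSpan_X1V/YXSpan_V.
Qed.

Lemma YXSpan_teval x z : YXSpan z -> YXSpan (teval g x * z).
Proof.
elim: x z => [[]|c|x IHx y IHy|x IHx y IHy] z Sz /=.
- exact: YXSpan_T.
- exact: YXSpan_V.
- exact: YXSpan_X1.
- exact: YXSpan_X1V.
- exact: YXSpan_X2.
- exact: YXSpan_X2V.
- exact: YXSpanY1.
- exact: YXSpanY1V.
- exact: YXSpanY2.
- exact: YXSpanY2V.
- exact: YXSpanZ.
- by rewrite mulrDl; apply: YXSpanD; [apply: IHx | apply: IHy].
- by rewrite -mulrA; apply/IHx/IHy.
Qed.

Section Image.
(** [I] will be the range of [Phi], viewed inside [H]. *)
Variable I : H -> Prop.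
Hypotheses (I_D : forall x y, I x -> I y -> I (x + y))
  (I_Z : forall c x, I x -> I (algin c * x))
  (I_M : forall x y, I x -> I y -> I (x * y))
  (I_e : I e) (I_img : forall s, I (val (sph_img s))).

Let I_N x y : I x -> I y -> I (x - y).
Proof.
move=> Ix Iy; apply: I_D => //.
by rewrite -mulN1r -(rmorphN1 (@algin k H)); apply: I_Z.
Qed.

Let e_inv x : T * x = x * T -> x * e = e * (x * e).
Proof. by move=> Tx; rewrite mulrA sph_e_comm // -(mulrA x e) pe. Qed.

Let I_inv x : T * x = x * T -> I (e * x * e) -> I (x * e).
Proof. by move=> Tx Ix; rewrite e_inv // mulrA. Qed.

Let e_eM x z : T * x = x * T -> I (x * e) -> I (e * z) -> I (e * (x * z)).
Proof.
move=> Tx Ix Iz; have -> : e * (x * z) = x * e * (e * z); last exact: I_M Ix Iz.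
by rewrite mulrA sph_e_comm // -(mulrA x e z) -(mulrA x e (e * z)) (mulrA e) pe.
Qed.

Let Ip1 : I ((X1 + X2) * e).
Proof. by apply: I_inv dTp1 _; apply: (I_img gP1). Qed.
Let Ip2 : I (X1 * X2 * e).
Proof. by apply: I_inv dTp2 _; apply: (I_img gP2). Qed.
Let Ip2V : I (X2V * X1V * e).
Proof. by apply: I_inv dTp2V _; apply: (I_img gP2V). Qed.
Let Iq1 : I ((Y1 + Y2) * e).
Proof. by apply: I_inv dTq1 _; apply: (I_img gQ1). Qed.
Let Iq2 : I (Y1 * Y2 * e).
Proof. by apply: I_inv dTq2 _; apply: (I_img gQ2). Qed.
Let Iq2V : I (Y2V * Y1V * e).
Proof. by apply: I_inv dTq2V _; apply: (I_img gQ2V). Qed.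

(** Here and in the next two lemmas the projection is a scalar multiple of the action of [P1], [Q1],
    [R] respectively; the third case is the reason for the generator [R]. *)
Lemma eX1_fixed z : T * z = algin t * z ->
  e * (X1 * z) = algin w * ((X1 + X2) * z).
Proof.
move=> Tz; have Vz : V * z = algin u * z.
  by rewrite dVE // Tz -mulrBl -rmorphB opprB addrC subrK.
rewrite sph_eM dTX1 Vz !linE; lin_split; ring: tu.
Qed.

Lemma eY1_fixed z : T * z = algin t * z ->
  e * (Y1 * z) = algin (w * t ^+ 2) * ((Y1 + Y2) * z).
Proof.
move=> Tz; rewrite sph_eM dTY1 Tz !linE.
have [wt _] := mul_inv_sqr tu ws.
lin_split; ring: tu wt.
Qed.

Lemma eY1X1_fixed z : T * z = algin t * z ->
  e * (Y1 * (X1 * z)) = algin (w * t ^+ 2) *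
    (Y1 * (X1 * z) + algin (u * u) * (Y2 * (X2 * z))).
Proof.
move=> Tz; have Vz : V * z = algin u * z.
  by rewrite dVE // Tz -mulrBl -rmorphB opprB addrC subrK.
rewrite sph_eM dTY1 dTX1 Vz !linE.
have [wt _] := mul_inv_sqr tu ws.
lin_split; ring: tu wt.
Qed.

(** Stands for the symmetric Laurent polynomials in [X1], [X2]; [xform] then describes the module
    that [1] and [X1] generate over them. *)
Let symX x := [/\ T * x = x * T, X1 * x = x * X1 & I (x * e)].

Let xform z := exists a b, [/\ symX a, symX b & z = a * e + X1 * (b * e)].

Let symXD x y : symX x -> symX y -> symX (x + y).
Proof.
move=> [Tx Xx Ix] [Ty Xy Iy]; split; rewrite ?mulrDr ?mulrDl ?Tx ?Ty ?Xx ?Xy //.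
exact: I_D.
Qed.

Let symXM x y : symX x -> symX y -> symX (x * y).
Proof.
move=> [Tx Xx Ix] [Ty Xy Iy]; split.
- by rewrite mulrA Tx -mulrA Ty mulrA.
- by rewrite mulrA Xx -mulrA Xy mulrA.
- by rewrite -mulrA e_inv // mulrA; apply: I_M.
Qed.

Let symXc c : symX (algin c).
Proof. by split; rewrite ?algin_comm // -algin_comm; apply: I_Z. Qed.

Let symX_p1 : symX (X1 + X2).
Proof. by split=> //; rewrite ?dTp1 // mulrDr mulrDl dXX. Qed.

Let symX_p2 : symX (X1 * X2).
Proof. by split=> //; rewrite ?dTp2 // {1}dXX mulrA. Qed.

Let dXXV : X1V * X2V = X2V * X1V.
Proof.
apply: (comm_inv dX2_X2V dX2V_X2); apply: esym.
by apply: (comm_inv dX1_X1V dX1V_X1); rewrite dXX.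
Qed.

Let symX_p2V : symX (X2V * X1V).
Proof.
case: symX_p2 => _ Xp2 _; split; rewrite ?dTp2V //; apply: comm_inv Xp2;
  apply: mul_inv2;
  by rewrite ?dX1_X1V ?dX2_X2V ?dX1V_X1 ?dX2V_X2.
Qed.

Let xformM x z : symX x -> xform z -> xform (x * z).
Proof.
move=> Sx [a [b [Sa Sb ->]]]; exists (x * a), (x * b).
split; try exact: symXM.
by case: Sx => _ Xx _; rewrite mulrDr -!mulrA [X1 * (x * _)]mulrA Xx !mulrA.
Qed.

Let xformD y z : xform y -> xform z -> xform (y + z).
Proof.
move=> [a [b [Sa Sb ->]]] [a' [b' [Sa' Sb' ->]]]; exists (a + a'), (b + b').
by split; try exact: symXD; rewrite !mulrDl mulrDr addrACA.
Qed.

Let xformX1 z : xform z -> xform (X1 * z).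
Proof.
move=> [a [b [Sa Sb ->]]].
(* [X1] is a root of [x^2 - (X1 + X2) x + X1 X2]. *)
exists (algin (-1) * (X1 * X2 * b)), (a + (X1 + X2) * b); split.
- by apply: symXM (symXc _) (symXM _ Sb).
- by apply: symXD Sa (symXM _ Sb).
by rewrite !linE rmorphN1 mulN1r [RHS]addrC !addrA addrK.
Qed.

Lemma xform_XSpan z : XSpan z -> xform z.
Proof.
have xX2 x : xform x -> xform (X2 * x).
  move=> Sx; have -> : X2 * x = (X1 + X2) * x + algin (-1) * (X1 * x).
    by rewrite mulrDl rmorphN1 mulN1r addrAC subrr add0r.
  by apply/xformD; apply: xformM => //; apply: xformX1.
elim=> {z}.
- exists 1, 0; rewrite -(rmorph1 (@algin k H)) -(rmorph0 (@algin k H)).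
  by split; try exact: symXc; rewrite rmorph1 rmorph0 mul1r mul0r mulr0 addr0.
- by move=> x y _ Sx _ Sy; apply: xformD.
- by move=> c x _ Sx; apply: xformM (symXc c) Sx.
- by move=> x _; apply: xformX1.
- by move=> x _; apply: xX2.
(* [X1^-1 = (X1 X2)^-1 X2], and likewise for [X2^-1] below. *)
- move=> x _ Sx; rewrite -[x](mulVK _ dX2V_X2) [X1V * _]mulrA dXXV.
  exact/xformM/xX2.
- move=> x _ Sx; rewrite -[x](mulVK _ dX1V_X1) [X2V * _]mulrA.
  exact/xformM/xformX1.
Qed.

(** The statement with [Y1 z] is carried along because [1] and [Y1] generate the Laurent polynomials
    in the [Y]'s over the symmetric ones, and symmetric factors can be pulled out of [e] by
    [e_eM]. *)
Lemma I_YXSpan z : YXSpan z -> I (e * z) /\ I (e * (Y1 * z)).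
Proof.
have fixT x : T * x = x * T -> T * (x * e) = algin t * (x * e).
  by move=> Tx; rewrite mulrA Tx -mulrA dTe mulrCA_scal.
have dYYV : Y1V * Y2V = Y2V * Y1V.
  apply: (comm_inv dY2_Y2V dY2V_Y2); apply: esym.
  by apply: (comm_inv dY1_Y1V dY1V_Y1); rewrite dYY.
have Y1Y2V : Y1 * Y2V = Y2V * Y1.
  by apply: (comm_inv dY2_Y2V dY2V_Y2); rewrite dYY.
have IY2 x : I (e * x) /\ I (e * (Y1 * x)) -> I (e * (Y2 * x)).
  move=> [Ix Ix']; have -> : Y2 * x = (Y1 + Y2) * x - Y1 * x.
    by rewrite mulrDl addrAC subrr add0r.
  by rewrite mulrBr; apply: I_N => //; apply: e_eM; rewrite ?dTq1.
have IR : I (Y1 * (X1 * e) + algin (u * u) * (Y2 * (X2 * e))).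
  by rewrite -RE; apply: I_img.
elim=> {z}.
- move=> _ /xform_XSpan[a [b [[Ta Xa Ia] [Tb Xb Ib] ->]]].
  rewrite !mulrDr; split; apply: I_D.
  + by rewrite -e_inv.
  + rewrite eX1_fixed ?fixT // e_inv // [_ * (e * _)]mulrA.
    by apply/I_Z/I_M => //; rewrite -e_inv.
  + rewrite eY1_fixed ?fixT // e_inv // [_ * (e * _)]mulrA.
    by apply/I_Z/I_M => //; rewrite -e_inv.
  + rewrite eY1X1_fixed ?fixT // e_inv //.
    set z := b * e; have -> : Y1 * (X1 * (e * z)) +
      algin (u * u) * (Y2 * (X2 * (e * z))) =
      (Y1 * (X1 * e) + algin (u * u) * (Y2 * (X2 * e))) * z.
      by rewrite mulrDl -!mulrA.
    by apply/I_Z/I_M.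
- by move=> x y _ [Ix Ix'] _ [Iy Iy']; rewrite !mulrDr; split; apply: I_D.
- by move=> c x _ [Ix Ix']; rewrite !scalY1 -!mulrCA_scal; split; apply: I_Z.
- move=> x _ [Ix Ix']; split=> //.
  have -> : Y1 * (Y1 * x) = (Y1 + Y2) * (Y1 * x) - Y1 * Y2 * x.
    by rewrite mulrDl dYYC -[Y1 * Y2 * x]mulrA addrK.
  by rewrite mulrBr; apply: I_N; apply: e_eM; rewrite ?dTq1 ?dTq2.
- move=> x _ IY1x; split; first exact: IY2.
  by case: IY1x => Ix _; rewrite [Y1 * _]mulrA; apply: e_eM => //; apply: dTq2.
- move=> x _ IY1x; rewrite (mulVK _ dY1_Y1V); split; last by case: IY1x.
  rewrite -[x](mulVK _ dY2V_Y2) [Y1V * _]mulrA dYYV.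
  by apply: e_eM (IY2 _ IY1x); rewrite ?dTq2V.
- move=> x _ IY1x; split.
    rewrite -[x](mulVK _ dY1V_Y1) [Y2V * _]mulrA.
    by apply: e_eM IY1x.2; rewrite ?dTq2V.
  (* [Y1 Y2^-1 = (Y1 Y2)^-1 Y1^2], with [Y1^2] reduced by the quadratic equation of [Y1]. *)
  have -> : Y1 * (Y2V * x) = Y2V * Y1V * ((Y1 + Y2) * (Y1 * x) - Y1 * Y2 * x).
    rewrite mulrDl dYYC -[Y1 * Y2 * x]mulrA addrK -mulrA (mulVK _ dY1V_Y1).
    by rewrite !mulrA Y1Y2V.
  case: IY1x => Ix Ix'; apply: e_eM; rewrite ?dTq2V // mulrBr.
  by apply: I_N; apply: e_eM; rewrite ?dTq1 ?dTq2.
Qed.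

Lemma I_corner (y : C) x : val y = e * teval g x * e -> I (val y).
Proof.
move=> ->; rewrite -mulrA; case: (@I_YXSpan (teval g x * e)) => //.
exact/YXSpan_teval/YXSpan_X/XSpan_e.
Qed.
End Image.
End DahaRelations.

(** * The monomials span [A] *)

Section ZPow.
Variables (A : pzRingType) (x xV : A).
Hypotheses (xxV : x * xV = 1) (xVx : xV * x = 1).

Lemma zpowSl n : x * zpow x xV n = zpow x xV (n + 1).
Proof.
case: n => [m|[|m]]; first by rewrite -PoszD addn1 /= exprS.
- by rewrite (_ : Negz 0 + 1 = 0) //= expr1 xxV.
- have -> : Negz m.+1 + 1 = Negz m.
    by rewrite !NegzE (intS m.+1) opprD addrAC addNr add0r.
  by rewrite /= exprS mulrA xxV mul1r.
Qed.

Lemma zpowPl n : xV * zpow x xV n = zpow x xV (n - 1).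
Proof.
have -> : n = n - 1 + 1 by rewrite subrK.
by rewrite -zpowSl mulrA xVx mul1r addrK.
Qed.

End ZPow.

Section SphericalSpan.
Variables (k : comUnitRingType) (t q : k).
Hypothesis (hq : q \is a GRing.unit).
Variables (A : pzAlgType k) (f : sph_gen -> A).
Hypothesis rel_f : respects (sph_rel t q) f.

Local Notation P1 := (f gP1).
Local Notation P2 := (f gP2).
Local Notation P2V := (f gP2V).
Local Notation Q1 := (f gQ1).
Local Notation Q2 := (f gQ2).
Local Notation Q2V := (f gQ2V).
Local Notation R := (f gR).
Local Notation v := (q ^- 2).

(** [sph_mon] in an arbitrary algebra, since it is needed both in [A] and in the corner. *)
Definition mon (j : nat * int * bool * nat * int) : A :=
  let: (a1, a2, eps, b1, b2) := j in
  Q1 ^+ a1 * zpow Q2 Q2V a2 * R ^+ eps * P1 ^+ b1 * zpow P2 P2V b2.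

Local Notation sp := (spans mon).

Let P2P2V : P2 * P2V = 1.
Proof. by have /= := rel_f (rel_P2_P2V t q); rewrite rmorph1. Qed.
Let P2VP2 : P2V * P2 = 1.
Proof. by have /= := rel_f (rel_P2V_P2 t q); rewrite rmorph1. Qed.
Let Q2Q2V : Q2 * Q2V = 1.
Proof. by have /= := rel_f (rel_Q2_Q2V t q); rewrite rmorph1. Qed.
Let Q2VQ2 : Q2V * Q2 = 1.
Proof. by have /= := rel_f (rel_Q2V_Q2 t q); rewrite rmorph1. Qed.
Let P2P1 : P2 * P1 = P1 * P2.
Proof. exact: rel_f (rel_P2P1 t q). Qed.
Let Q2Q1 : Q2 * Q1 = Q1 * Q2.
Proof. exact: rel_f (rel_Q2Q1 t q). Qed.
Let P2Q2 : P2 * Q2 = algin (q ^- 4) * (Q2 * P2).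
Proof. exact: rel_f (rel_P2Q2 t q). Qed.
Let P2Q1 : P2 * Q1 = algin v * (Q1 * P2).
Proof. exact: rel_f (rel_P2Q1 t q). Qed.
Let P1Q2 : P1 * Q2 = algin v * (Q2 * P1).
Proof. exact: rel_f (rel_P1Q2 t q). Qed.
Let P1Q1 : P1 * Q1 = Q1 * P1 + algin (v - 1) * R.
Proof. exact: rel_f (rel_P1Q1 t q). Qed.
Let P2R : P2 * R = algin v * (R * P2).
Proof. exact: rel_f (rel_P2R t q). Qed.
Let RQ2 : R * Q2 = algin v * (Q2 * R).
Proof. exact: rel_f (rel_RQ2 t q). Qed.
Let P1R : P1 * R = algin v * (R * P1) + algin (1 - v) * (Q1 * P2).
Proof. exact: rel_f (rel_P1R t q). Qed.
Let RQ1 : R * Q1 = algin v * (Q1 * R) + algin (1 - v) * (Q2 * P1).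
Proof. exact: rel_f (rel_RQ1 t q). Qed.
Let RR : R * R = algin ((1 + t ^+ 2) * (v + t ^- 2)) * (Q2 * P2)
   + algin (-1) * (algin v * (Q2 * (P1 * P1)))
   + algin (-1) * (algin v * (Q1 * Q1 * P2))
   + algin v * (Q1 * R * P1).
Proof. exact: rel_f (rel_RR t q). Qed.

Lemma qcomm_inv (x y yV : A) c : c \is a GRing.unit ->
  y * yV = 1 -> yV * y = 1 -> x * y = algin c * (y * x) ->
  x * yV = algin c^-1 * (yV * x).
Proof.
move=> uc yyV yVy xy.
rewrite -[x * yV]mul1r -yVy -!mulrA [y * (x * _)]mulrA.
have -> : y * x = algin c^-1 * (x * y).
  by rewrite xy mulrA -rmorphM mulVr // rmorph1 mul1r.
by rewrite -mulrA -(mulrA x) yyV mulr1 !mulrA algin_comm.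
Qed.

Let uv : v \is a GRing.unit. Proof. by rewrite unitrV unitrX. Qed.
Let uv2 : q ^- 4 \is a GRing.unit. Proof. by rewrite unitrV unitrX. Qed.

Lemma qcomm_sym (x y : A) c : c \is a GRing.unit ->
  x * y = algin c * (y * x) -> y * x = algin c^-1 * (x * y).
Proof. by move=> uc ->; rewrite mulrA -rmorphM mulVr // rmorph1 mul1r. Qed.

Let tail b1 b2 := P1 ^+ b1 * zpow P2 P2V b2.

Let tailE b1 b2 : tail b1 b2 = mon (0%N, 0, false, b1, b2).
Proof. by rewrite /mon /= !expr0 !mul1r. Qed.
Let RtailE b1 b2 : R * tail b1 b2 = mon (0%N, 0, true, b1, b2).
Proof. by rewrite /mon /= !expr0 !mul1r expr1 mulrA. Qed.
Let sp_tail b1 b2 : sp (tail b1 b2).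
Proof. by rewrite tailE; apply: spans_gen. Qed.
Let sp_Rtail b1 b2 : sp (R * tail b1 b2).
Proof. by rewrite RtailE; apply: spans_gen. Qed.
Let P1tail b1 b2 : P1 * tail b1 b2 = tail b1.+1 b2.
Proof. by rewrite /tail exprS mulrA. Qed.
Let commXn (x y : A) n : x * y = y * x -> x * y ^+ n = y ^+ n * x.
Proof. exact: commrX. Qed.
Let P2tail b1 b2 : P2 * tail b1 b2 = tail b1 (b2 + 1).
Proof. by rewrite /tail mulrA commXn // -mulrA zpowSl. Qed.
Let P2Vtail b1 b2 : P2V * tail b1 b2 = tail b1 (b2 - 1).
Proof.
rewrite /tail mulrA commXn -?mulrA ?zpowPl //.
by apply/esym/(comm_inv P2P2V P2VP2); rewrite P2P1.
Qed.

Lemma sp_Q1 x : sp x -> sp (Q1 * x).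
Proof.
apply: spans_mull => -[[[[a1 a2] eps] b1] b2] /=.
by rewrite !mulrA -exprS; apply: (spans_gen _ (a1.+1, a2, eps, b1, b2)).
Qed.

Lemma sp_Q2 x : sp x -> sp (Q2 * x).
Proof.
apply: spans_mull => -[[[[a1 a2] eps] b1] b2] /=.
rewrite !mulrA (commXn _ Q2Q1) -(mulrA _ Q2) zpowSl //.
by apply: (spans_gen _ (a1, a2 + 1, eps, b1, b2)).
Qed.

Lemma sp_Q2V x : sp x -> sp (Q2V * x).
Proof.
apply: spans_mull => -[[[[a1 a2] eps] b1] b2] /=.
have Q2VQ1 : Q2V * Q1 = Q1 * Q2V.
  by apply/esym/(comm_inv Q2Q2V Q2VQ2); rewrite Q2Q1.
rewrite !mulrA (commXn _ Q2VQ1) -(mulrA _ Q2V) zpowPl //.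
by apply: (spans_gen _ (a1, a2 - 1, eps, b1, b2)).
Qed.

(* Left multiplication by [Q1] and [Q2] preserves this property, because the
   relations move [P1] and [R] to the right of [Q1] and [Q2]. *)
Let stable x := [/\ sp x, sp (P1 * x) & sp (R * x)].

Let stable_Q1 x : stable x -> stable (Q1 * x).
Proof.
move=> [Sx SP SR]; split; first exact: sp_Q1.
- rewrite mulrA P1Q1 mulrDl -!mulrA.
  by apply: spansD; [apply: sp_Q1 | apply: spansZ].
- rewrite mulrA RQ1 mulrDl -!mulrA.
  by apply: spansD; apply: spansZ; [apply: sp_Q1 | apply: sp_Q2].
Qed.

Let stable_Q2 x : stable x -> stable (Q2 * x).
Proof.
move=> [Sx SP SR]; split; first exact: sp_Q2.
- by rewrite mulrA P1Q2 -!mulrA; apply/spansZ/sp_Q2.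
- by rewrite mulrA RQ2 -!mulrA; apply/spansZ/sp_Q2.
Qed.

Let stable_Q2V x : stable x -> stable (Q2V * x).
Proof.
move=> [Sx SP SR]; split; first exact: sp_Q2V.
- rewrite mulrA (qcomm_inv uv Q2Q2V Q2VQ2 P1Q2) -!mulrA.
  exact/spansZ/sp_Q2V.
- rewrite mulrA (qcomm_inv uv Q2Q2V Q2VQ2 RQ2) -!mulrA.
  exact/spansZ/sp_Q2V.
Qed.

Lemma mon_ind (S : A -> Prop) :
  (forall x, S x -> S (Q1 * x)) -> (forall x, S x -> S (Q2 * x)) ->
  (forall x, S x -> S (Q2V * x)) -> (forall b1 b2, S (tail b1 b2)) ->
  (forall b1 b2, S (R * tail b1 b2)) -> forall j, S (mon j).
Proof.
move=> SQ1 SQ2 SQ2V St SRt [[[[a1 a2] eps] b1] b2] /=.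
have S0 : S (R ^+ eps * tail b1 b2).
  by case: eps; rewrite ?expr1 // expr0 mul1r.
rewrite -!mulrA; elim: a1 => [|a1 IH]; last by rewrite exprS -mulrA; apply: SQ1.
rewrite expr0 mul1r; case: a2 => m /=.
  elim: m => [|m IH]; first by rewrite expr0 mul1r.
  by rewrite exprS -mulrA; apply: SQ2.
elim: m => [|m IH]; first by rewrite expr1; apply: SQ2V.
by rewrite exprS -mulrA; apply: SQ2V.
Qed.

Let stable_mon j : stable (mon j).
Proof.
apply: mon_ind j => // b1 b2.
  by split; rewrite ?P1tail.
split=> //.
- rewrite mulrA P1R mulrDl -!mulrA P1tail P2tail.
  by apply: spansD; apply: spansZ => //; apply: sp_Q1.
- rewrite mulrA RR !mulrDl -!mulrA !(P1tail, P2tail).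
  by do ![apply: spansD]; do ?apply: spansZ;
    do ?[apply: sp_Q1 | apply: sp_Q2].
Qed.

(** [P2] commutes with every other generator up to a unit and creates no further terms, so it can be
    treated apart from [P1] and [R]. *)
Let p2stable x := sp (P2 * x) /\ sp (P2V * x).

Let P2VM y c x : c \is a GRing.unit -> P2 * y = algin c * (y * P2) ->
  P2V * (y * x) = algin c^-1 * (y * (P2V * x)).
Proof.
move=> uc P2y; have uc' : c^-1 \is a GRing.unit by rewrite unitrV.
have E := qcomm_inv uc' P2P2V P2VP2 (qcomm_sym uc P2y).
by rewrite mulrA (qcomm_sym _ E) ?invrK // -!mulrA.
Qed.

Let p2stable_mon j : p2stable (mon j).
Proof.
have P2V_Q1 := qcomm_sym uv P2Q1.
apply: mon_ind j => [x [S SV]|x [S SV]|x [S SV]|b1 b2|b1 b2].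
- split; first by rewrite mulrA P2Q1 -!mulrA; apply/spansZ/sp_Q1.
  by rewrite (P2VM _ uv P2Q1); apply/spansZ/sp_Q1.
- split; first by rewrite mulrA P2Q2 -!mulrA; apply/spansZ/sp_Q2.
  by rewrite (P2VM _ uv2 P2Q2); apply/spansZ/sp_Q2.
- have P2Q2V := qcomm_inv uv2 Q2Q2V Q2VQ2 P2Q2.
  have uw : (q ^- 4)^-1 \is a GRing.unit by rewrite unitrV.
  split; first by rewrite mulrA P2Q2V -!mulrA; apply/spansZ/sp_Q2V.
  by rewrite (P2VM _ uw P2Q2V); apply/spansZ/sp_Q2V.
- by split; rewrite ?P2tail ?P2Vtail.
- split; first by rewrite mulrA P2R -!mulrA P2tail; apply: spansZ.
  by rewrite (P2VM _ uv P2R) P2Vtail; apply: spansZ.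
Qed.

Lemma mon_teval x : sp (teval f x).
Proof.
suff H z : sp z -> sp (teval f x * z).
  have -> : teval f x = teval f x * mon (0%N, 0, false, 0%N, 0).
    by rewrite /mon /= !expr0 !mulr1.
  exact/H/spans_gen.
elim: x z => [[]|c|x IHx y IHy|x IHx y IHy] z Sz /=.
- by apply: spans_mull Sz => j; case: (stable_mon j).
- by apply: spans_mull Sz => j; case: (p2stable_mon j).
- by apply: spans_mull Sz => j; case: (p2stable_mon j).
- exact: sp_Q1.
- exact: sp_Q2.
- exact: sp_Q2V.
- by apply: spans_mull Sz => j; case: (stable_mon j).
- exact: spansZ.
- by rewrite mulrDl; apply: spansD; [apply: IHx | apply: IHy].
- by rewrite -mulrA; apply/IHx/IHy.
Qed.

End SphericalSpan.

(** * Independence of the monomials *)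

Section Action.
Variables (k : comNzRingType) (I : Type).
Variable rel : term k I -> term k I -> Prop.
Variables (K : comNzRingType) (io : {rmorphism k -> K}) (W : Type).
Variable op : I -> (W -> K) -> W -> K.

(** Arbitrary maps on [W -> K] do not form a ring: [x (y + z) = x y + x z] needs [x] to be additive.
    Therefore [plift] does not apply; terms act directly, and [op_linear] supplies the missing
    laws. *)
Fixpoint taction (x : term k I) (f : W -> K) : W -> K :=
  match x with
  | Var i => op i f
  | Cst c => fun w => io c * f w
  | Add x y => fun w => taction x f w + taction y f w
  | Mul x y => taction x (taction y f)
  end.

Hypothesis op_linear : forall i c f g,
  op i (fun w => c * f w + g w) = fun w => c * op i f w + op i g w.
Hypothesis op_rel : forall x y, rel x y -> taction x = taction y.

Lemma taction_linear x c f g :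
  taction x (fun w => c * f w + g w) =
  fun w => c * taction x f w + taction x g w.
Proof.
elim: x f g => [i|a|x IHx y IHy|x IHx y IHy] f g /=; first exact: op_linear.
- by apply/funext => w; ring.
- by apply/funext => w; rewrite IHx IHy; ring.
- by rewrite IHy IHx.
Qed.

Lemma taction_congr x y : congr rel x y -> taction x = taction y.
Proof.
elim=> {x y} //=.
- by move=> x y z _ -> _ ->.
- by move=> x x' y y' _ -> _ ->.
- by move=> x x' y y' _ -> _ ->.
- by move=> x y z; apply/funext => f; apply/funext => w; rewrite addrA.
- by move=> x y; apply/funext => f; apply/funext => w; rewrite addrC.
- move=> x; apply/funext => f; apply/funext => w.
  by rewrite rmorph0 mul0r add0r.
- by move=> x; apply/funext => f; apply/funext => w; rewrite rmorph1 mul1r.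
- by move=> x; apply/funext => f; apply/funext => w; rewrite rmorph0 !mul0r.
- move=> x y z; apply/funext => f; apply/funext => w.
  have := congr1 (@^~ w) (taction_linear x 1 (taction y f) (taction z f)).
  rewrite mul1r => <-; congr (taction x _ w).
  by apply/funext => w'; rewrite mul1r.
- by move=> a b; apply/funext => f; apply/funext => w; rewrite rmorphD mulrDl.
- by move=> a b; apply/funext => f; apply/funext => w; rewrite rmorphM mulrA.
- move=> a x; apply/funext => f; apply/funext => w.
  have := congr1 (@^~ w) (taction_linear x (io a) f (fun=> 0)).
  (* The factor [-1] with two zero functions shows that the zero function is mapped to zero. *)
  have := congr1 (@^~ w) (taction_linear x (-1) (fun=> 0) (fun=> 0)).
  rewrite /= mulN1r addNr => E0.
  have -> : taction x (fun=> 0) w = 0 by rewrite E0 mulN1r addNr.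
  rewrite addr0 => <-; congr (taction x _ w).
  by apply/funext => w'; rewrite addr0.
Qed.

Definition action (x : presented rel) := taction (repr x).

Lemma action_cls x : action (cls rel x) = taction x.
Proof. exact/taction_congr/repr_cls. Qed.

Lemma action_gen i : action (gen rel i) = op i.
Proof. exact: action_cls. Qed.

Lemma actionD x y f w : action (x + y) f w = action x f w + action y f w.
Proof.
by elim/clsW: x => x; elim/clsW: y => y; rewrite -cls_add !action_cls.
Qed.

Lemma actionM x y f : action (x * y) f = action x (action y f).
Proof.
by elim/clsW: x => x; elim/clsW: y => y; rewrite -cls_mul !action_cls.
Qed.

Lemma action_algin c f w : action (algin c) f w = io c * f w.
Proof. by rewrite -cls_cst action_cls. Qed.

End Action.

(** * Independence of the products of powers of [a + b] and [a b] *)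

Section SymmetricFunctionsIndependence.
Variable L : fieldType.

Local Notation PP := {poly {poly L}}.
Local Notation X := ('X : PP).
Local Notation Y := (('X%:P) : PP).

(** [(X + Y)^i (X Y)^j] has [X^j Y^(i+j)] as its term of lowest degree in [X], so these coefficients
    form a unitriangular system when ordered by [j]. *)
Lemma coef_sumXY_prodXY i j i' j' : (j <= j')%N ->
  (((X + Y) ^+ i' * (X * Y) ^+ j')`_j)`_(i + j) = ((i', j') == (i, j))%:R :> L.
Proof.
move=> lej; rewrite exprMn mulrCA mulrC coefMXn.
have [ltj|lej'] := ltnP j j'.
  by rewrite coef0 xpair_eqE (gtn_eqF ltj) andbF.
have {lej lej'} -> : j' = j by apply/eqP; rewrite eqn_leq lej lej'.
rewrite subnn xpair_eqE eqxx andbT -rmorphXn /= coefMC -horner_coef0.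
rewrite horner_exp hornerD hornerX hornerC add0r -exprD coefXn.
by rewrite eqn_add2r eq_sym.
Qed.

Lemma sumXY_prodXY_free (s : seq (nat * nat)) (c : nat * nat -> L) : uniq s ->
  \sum_(p <- s) (c p)%:P%:P * ((X + Y) ^+ p.1 * (X * Y) ^+ p.2) = 0 ->
  forall p, p \in s -> c p = 0.
Proof.
move=> us s0 [i j]; elim/ltn_ind: j i => j IH i ps.
have := congr1 (fun x : PP => x`_j`_(i + j)) s0.
rewrite !coef0 coef_sum coef_sum (bigD1_seq (i, j)) //= big1_seq => [|p].
  by rewrite !coefCM coef_sumXY_prodXY // eqxx mulr1 addr0.
case/andP=> pij ps'; rewrite !coefCM; have [lt|ge] := ltnP p.2 j.
  by rewrite [c p](_ : _ = 0) ?mul0r //; case: (p) lt ps' => ? ? /= /IH; apply.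
by rewrite coef_sumXY_prodXY // -surjective_pairing (negbTE pij) mulr0.
Qed.

Local Notation K := {fraction PP}.
Definition genX : K := tofrac X.
Definition genY : K := tofrac Y.
Definition constK (c : L) : K := tofrac c%:P%:P.

Lemma genX_neq0 : genX != 0.
Proof. by rewrite tofrac_eq0 polyX_eq0. Qed.

Lemma genY_neq0 : genY != 0.
Proof. by rewrite tofrac_eq0 polyC_eq0 polyX_eq0. Qed.

Lemma genX_neq_genY c : genX != constK c * genY.
Proof.
rewrite -tofracM tofrac_eq; apply/eqP => /(congr1 (fun p : PP => p`_1)).
rewrite -rmorphM /= coefX coefC /= => /eqP; rewrite oner_eq0 //.
Qed.

Lemma genY_neq_genX c : genY != constK c * genX.
Proof.
rewrite -tofracM tofrac_eq; apply/eqP => /(congr1 (fun p : PP => p`_0)).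
by rewrite coefMX coefC /= => /eqP; rewrite polyX_eq0.
Qed.

Lemma genX_genY_free (s : seq (nat * int)) (c : nat * int -> L) : uniq s ->
  \sum_(p <- s) constK (c p) *
    ((genX + genY) ^+ p.1 * (genX * genY) ^ p.2) = 0 ->
  forall p, p \in s -> c p = 0.
Proof.
move=> us s0.
have g0 : genX * genY != 0.
  exact: mulf_neq0 genX_neq0 genY_neq0.
(* [N] bounds every [|p.2|], so multiplying by [(X Y)^N] clears the negative powers. *)
pose N := (\sum_(p <- s) `|p.2|)%N.
pose sh (p : nat * int) := (p.1, absz (p.2 + N%:Z)).
have sN p : p \in s -> (absz (p.2 + N%:Z))%:Z = p.2 + N%:Z.
  move=> ps; apply: gez0_abs; rewrite -lerBlDr sub0r lerNl.
  apply: le_trans (ler_norm _) _; rewrite normrN -abszE lez_nat.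
  by rewrite /N (big_rem p) //= leq_addr.
pose c' (r : nat * nat) := c (r.1, r.2%:Z - N%:Z).
have c'E p : p \in s -> c' (sh p) = c p.
  by move=> ps; rewrite /c' /= sN // addrK -surjective_pairing.
have us' : uniq [seq sh p | p <- s].
  rewrite map_inj_in_uniq // => -[i j] [i' j'] ps ps' [-> E].
  by congr (_, _); apply: (addIr N%:Z); rewrite -(sN _ ps) -(sN _ ps') /= E.
have {}s0 : \sum_(r <- [seq sh p | p <- s])
    (c' r)%:P%:P * ((X + Y) ^+ r.1 * (X * Y) ^+ r.2) = 0.
  apply/eqP; rewrite -tofrac_eq0 big_map rmorph_sum /=; apply/eqP.
  rewrite -[RHS](mulr0 ((genX * genY) ^ N%:Z)) -[in RHS]s0 mulr_sumr.
  rewrite big_seq [RHS]big_seq; apply: eq_bigr => p ps.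
  rewrite c'E // !(tofracM, tofracXn, tofracD) -/genX -/genY -/(constK _).
  rewrite -[(genX * genY) ^+ _]/((genX * genY) ^ (absz _)%:Z) sN //.
  rewrite (expfzDr _ _ g0).
  by move: (_ ^ p.2) (_ ^ N%:Z) (constK _) (_ ^+ p.1) => x y z d; ring.
move=> p ps; rewrite -c'E //.
exact: (sumXY_prodXY_free us' s0 (map_f sh ps)).
Qed.

End SymmetricFunctionsIndependence.

(* The representation of [H] induced from a generic point [(a, b)] of the
   torus of [X1] and [X2].  The functions live on the extended affine Weyl
   group and not on its orbit of points, so that nothing degenerates when [q]
   is a root of unity.  [T] acts by a Demazure-Lusztig operator, and [pw] is
   the action of [T^-1 Y1], for which [T^-1 Y1 X2 = X1 T^-1 Y1] and
   [T^-1 Y1 X1 = q^2 X2 T^-1 Y1]. *)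
Section GenericRepresentation.
Variables (k : comUnitRingType) (t q : k).
Hypotheses (ht : t \is a GRing.unit) (hq : q \is a GRing.unit).
Variables (K : fieldType) (io : {rmorphism k -> K}) (a b : K).
Hypotheses (a_neq0 : a != 0) (b_neq0 : b != 0).
Hypothesis a_neq_b : forall c, a != io c * b.
Hypothesis b_neq_a : forall c, b != io c * a.

Local Notation W := (bool * int * int)%type.
Local Notation Q := (io q ^+ 2).
Local Notation tau := (io t).

(** [(x1 w, x2 w)] is the point to which [w] moves [(a, b)]: swapped when [s] holds, then scaled by
    [Q^m] and [Q^n]. *)
Definition x1 (w : W) := let: (s, m, n) := w in Q ^ m * (if s then b else a).
Definition x2 (w : W) := let: (s, m, n) := w in Q ^ n * (if s then a else b).
Definition sw (w : W) : W := let: (s, m, n) := w in (~~ s, n, m).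
Definition pw (w : W) : W := let: (s, m, n) := w in (~~ s, n + 1, m).
Definition pVw (w : W) : W := let: (s, m, n) := w in (~~ s, n, m - 1).

Let tau0 : tau != 0. Proof. by rewrite -unitfE rmorph_unit. Qed.
Let q0 : io q != 0. Proof. by rewrite -unitfE rmorph_unit. Qed.
Let Q0 : Q != 0. Proof. by rewrite expf_neq0. Qed.

Lemma swK w : sw (sw w) = w.
Proof. by case: w => [[s m] n] /=; rewrite negbK. Qed.
Lemma pwK w : pVw (pw w) = w.
Proof. by case: w => [[s m] n] /=; rewrite negbK addrK. Qed.
Lemma pVwK w : pw (pVw w) = w.
Proof. by case: w => [[s m] n] /=; rewrite negbK subrK. Qed.
Lemma sw_pw2 w : sw (pw (pw w)) = pw (pw (sw w)).
Proof. by case: w => [[s m] n]. Qed.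

Lemma x1_sw w : x1 (sw w) = x2 w.
Proof. by case: w => [[[] m] n]. Qed.
Lemma x2_sw w : x2 (sw w) = x1 w.
Proof. by case: w => [[[] m] n]. Qed.
Lemma x1_pw w : x1 (pw w) = Q * x2 w.
Proof.
case: w => [[s m] n] /=.
by rewrite expfzDr // expr1z if_neg [Q * _]mulrCA mulrA.
Qed.
Lemma x2_pw w : x2 (pw w) = x1 w.
Proof. by case: w => [[[] m] n]. Qed.

Lemma x1_neq0 w : x1 w != 0.
Proof. by case: w => [[[] m] n] /=; rewrite mulf_neq0 // expfz_neq0. Qed.
Lemma x2_neq0 w : x2 w != 0.
Proof. by case: w => [[[] m] n] /=; rewrite mulf_neq0 // expfz_neq0. Qed.

(** Powers of [Q] lie in the image of [io], so the genericity of [(a, b)] passes to its whole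
    orbit. *)
Lemma x1_neq_x2 c w : x1 w != io c * x2 w.
Proof.
have QE n : Q ^ n = io ((q ^+ 2) ^ n) by rewrite rmorphXz ?rmorphXn ?unitrX.
case: w => [[s m] n] /=.
have E x y : (Q ^ m * x == io c * (Q ^ n * y)) =
    (x == io (c * (q ^+ 2) ^ (n - m)) * y).
  rewrite rmorphM -QE expfzDr // -invr_expz.
  apply/eqP/eqP => [E|->]; last first.
    by rewrite mulrC -!mulrA; congr (_ * _); field; rewrite expfz_neq0.
  apply: (mulfI (expfz_neq0 m Q0)); rewrite E.
  by field; rewrite expfz_neq0.
by case: s; rewrite E.
Qed.

Lemma x2B1_neq0 w : x2 w - x1 w != 0.
Proof.
rewrite subr_eq0 eq_sym; have := x1_neq_x2 1 w.
by rewrite rmorph1 mul1r.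
Qed.

Local Notation hK := (tau - tau^-1).
(** Coefficients of the Demazure-Lusztig operator. They add up to [tau], so that swap-invariant
    functions are eigenvectors of [T] with eigenvalue [tau]. *)
Definition dT (w : W) := hK * x2 w / (x2 w - x1 w).
Definition cT (w : W) := tau - dT w.

Lemma cT_neq0 w : cT w != 0.
Proof.
have := x1_neq_x2 (t ^- 2) w; apply: contra_neq => E.
have : cT w * (x2 w - x1 w) = 0 by rewrite E mul0r.
have -> : cT w * (x2 w - x1 w) = tau^-1 * x2 w - tau * x1 w.
  by rewrite /cT /dT; field; rewrite tau0 x2B1_neq0.
move=> /eqP; rewrite subr_eq0 => /eqP E'; apply: (mulfI tau0).
rewrite -E' rmorphV ?unitrX // rmorphXn; field; exact: tau0.
Qed.

Definition opT (f : W -> K) w := dT w * f w + cT w * f (sw w).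
Definition opV (f : W -> K) w := opT f w - hK * f w.

Definition daha_op (g : daha_gen) (f : W -> K) : W -> K :=
  match g with
  | gT => opT f
  | gTV => opV f
  | gX1 => fun w => x1 w * f w
  | gX1V => fun w => (x1 w)^-1 * f w
  | gX2 => fun w => x2 w * f w
  | gX2V => fun w => (x2 w)^-1 * f w
  | gY1 => opT (fun w => f (pw w))
  | gY1V => fun w => opV f (pVw w)
  | gY2 => fun w => opV f (pw w)
  | gY2V => opT (fun w => f (pVw w))
  end.

Lemma daha_op_linear g c f f' :
  daha_op g (fun w => c * f w + f' w) =
  fun w => c * daha_op g f w + daha_op g f' w.
Proof. by case: g; apply/funext => w; rewrite /= /opV /opT; ring. Qed.

Lemma dT_sw w : dT (sw w) = hK - dT w.
Proof.
rewrite /dT x1_sw x2_sw; have := x2B1_neq0 w.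
move: (x1 w) (x2 w) => x y xy.
by field; rewrite xy tau0 -oppr_eq0 opprB xy.
Qed.

Lemma opT_quad f : opT (opT f) = fun w => hK * opT f w + f w.
Proof.
apply/funext => w; rewrite /opT /cT swK dT_sw /dT; have := x2B1_neq0 w.
move: (x1 w) (x2 w) => x y xy.
by field; rewrite xy tau0.
Qed.

Lemma opTV f : opT (opV f) = f.
Proof.
have -> : opT (opV f) = fun w => opT (opT f) w - hK * opT f w.
  by apply/funext => w; rewrite /opV /opT; ring.
by apply/funext => w; rewrite opT_quad; ring.
Qed.

Lemma opVT f : opV (opT f) = f.
Proof. by apply/funext => w; rewrite /opV opT_quad; ring. Qed.

Lemma opTX1T f : opT (fun w => x1 w * opT f w) = fun w => x2 w * f w.
Proof.
apply/funext => w; rewrite /opT /cT swK dT_sw x1_sw /dT; have := x2B1_neq0 w.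
move: (x1 w) (x2 w) => x y xy.
by field; rewrite xy tau0.
Qed.

Lemma opVX1V f : opV (fun w => (x1 w)^-1 * opV f w) = fun w => (x2 w)^-1 * f w.
Proof.
set g := fun w => _ * f w.
have -> : f = fun w => x2 w * g w.
  by apply/funext => w; rewrite /g mulVKf ?x2_neq0.
rewrite -opTX1T opVT -[RHS]opVT; congr opV.
by apply/funext => w; rewrite mulKf ?x1_neq0.
Qed.

(** [pw] applied twice scales both coordinates by [Q], and [dT] depends only on their ratio. This
    yields [Y1 Y2 = Y2 Y1]. *)
Lemma dT_pw2 w : dT (pw (pw w)) = dT w.
Proof.
rewrite /dT !(x1_pw, x2_pw); have := x2B1_neq0 w; move: (x1 w) (x2 w) => x y xy.
by field; rewrite xy tau0 -mulrBr mulf_neq0.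
Qed.

Lemma opT_pw2 f : opT (fun w => f (pw (pw w))) = fun w => opT f (pw (pw w)).
Proof. by apply/funext => w; rewrite /opT /cT dT_pw2 sw_pw2. Qed.

Local Notation act := (taction io daha_op).

Lemma daha_op_rel x y : daha_rel t q x y -> act x = act y.
Proof.
case=> /=; apply/funext => f /=.
- by rewrite opTV; apply/funext => w; rewrite rmorph1 mul1r.
- by rewrite opVT; apply/funext => w; rewrite rmorph1 mul1r.
- by apply/funext => w; rewrite rmorph1 mulVKf ?mul1r ?x1_neq0.
- by apply/funext => w; rewrite rmorph1 mulKf ?mul1r ?x1_neq0.
- by apply/funext => w; rewrite rmorph1 mulVKf ?mul1r ?x2_neq0.
- by apply/funext => w; rewrite rmorph1 mulKf ?mul1r ?x2_neq0.
- apply/funext => w; rewrite rmorph1 mul1r; under eq_fun do rewrite pwK.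
  by rewrite opTV.
- by rewrite opVT; apply/funext => w; rewrite pVwK rmorph1 mul1r.
- by rewrite opVT; apply/funext => w; rewrite pwK rmorph1 mul1r.
- apply/funext => w; rewrite rmorph1 mul1r; under eq_fun do rewrite pVwK.
  by rewrite opTV.
- exact: opTX1T.
- by rewrite opVT.
- by apply/funext => w; rewrite mulrCA.
- rewrite opT_pw2 opTV.
  by apply/funext => w; rewrite opVT.
- apply/funext => w; rewrite rmorphXn.
  rewrite /opT !(x1_pw, x2_pw, x1_sw, x2_sw); ring.
- by apply/funext => w; rewrite opVX1V x2_pw.
- apply/funext => w; rewrite rmorph0 mul0r rmorphN1 rmorphV //.
  have := congr1 (@^~ w) (opT_quad f); rewrite /opT => /eqP.
  by rewrite -subr_eq0 => /eqP <-; field.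
Qed.

(** * Action of the spherical subalgebra on symmetric functions *)

Variables (H : pzAlgType k) (g : daha_gen -> H).
Hypothesis rel_g : respects (daha_rel t q) g.
Variable e : H.
Hypothesis eE : e = algin (1 + t ^+ 2)^-1 * (1 + algin t * g gT).
Variable act : H -> (W -> K) -> W -> K.
Hypothesis actD : forall x y f w, act (x + y) f w = act x f w + act y f w.
Hypothesis actM : forall x y f, act (x * y) f = act x (act y f).
Hypothesis act_algin : forall c f w, act (algin c) f w = io c * f w.
Hypothesis act_gen : forall s, act (g s) = daha_op s.

Lemma act1 f : act 1 f = f.
Proof.
apply/funext => w; rewrite -(rmorph1 (@algin k H)).
by rewrite [LHS]act_algin rmorph1 mul1r.
Qed.

(** Swap-invariant functions on [W] are encoded by their values [F m n] at the points
    [(Q^m a, Q^n b)]. *)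
Definition sym_ext (F : int -> int -> K) (w : W) : K :=
  let: (s, m, n) := w in if s then F n m else F m n.

Lemma act0 f w : act 0 f w = 0.
Proof.
by rewrite -(rmorph0 (@algin k H)) [LHS]act_algin rmorph0 mul0r.
Qed.

Lemma sym_ext_sw F w : sym_ext F (sw w) = sym_ext F w.
Proof. by case: w => [[[] m] n]. Qed.

Lemma opT_ext F : opT (sym_ext F) = fun w => tau * sym_ext F w.
Proof. by apply/funext => w; rewrite /opT /cT sym_ext_sw; ring. Qed.

Lemma opV_ext F : opV (sym_ext F) = fun w => tau^-1 * sym_ext F w.
Proof. by apply/funext => w; rewrite /opV opT_ext; ring. Qed.

Hypothesis hs : t ^+ 2 + 1 \is a GRing.unit.

Lemma act_e F : act e (sym_ext F) = sym_ext F.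
Proof.
apply/funext => w.
rewrite eE actM act_algin actD act1 actM act_algin act_gen /= opT_ext.
have s0 : io (1 + t ^+ 2) != 0 by rewrite -unitfE rmorph_unit // addrC.
rewrite rmorphV; last by rewrite addrC.
by move: s0; rewrite rmorphD rmorph1 rmorphXn => s0; field.
Qed.

Local Notation c m n := (cT (false, m, n)).
Local Notation c' m n := (cT (true, n, m)).

(** [gQ1] is the Macdonald q-difference operator in two variables, with shift [Q]. *)
Definition sph_op (g : sph_gen) (F : int -> int -> K) : int -> int -> K :=
  match g with
  | gP1 => fun m n => (Q ^ m * a + Q ^ n * b) * F m n
  | gP2 => fun m n => Q ^ m * a * (Q ^ n * b) * F m n
  | gP2V => fun m n => (Q ^ m * a * (Q ^ n * b))^-1 * F m n
  | gQ1 => fun m n => c m n * F (m + 1) n + c' m n * F m (n + 1)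
  | gQ2 => fun m n => F (m + 1) (n + 1)
  | gQ2V => fun m n => F (m - 1) (n - 1)
  | gR => fun m n => Q * (Q ^ m * a * c m n * F (m + 1) n
                        + Q ^ n * b * c' m n * F m (n + 1))
  end.

Variable pe : e * e = e.
Local Notation img := (sph_img t g pe).

Lemma cT_sw w : cT (sw w) = dT w + tau^-1.
Proof. by rewrite /cT dT_sw; ring. Qed.

Lemma dT_sub w : dT w * (x2 w - x1 w) = hK * x2 w.
Proof. by rewrite /dT divfK // x2B1_neq0. Qed.

Let opE := (actD, actM, act_algin, act_gen, sym_ext_sw, opV_ext).

Lemma act_img s F : act (val (img s)) (sym_ext F) = sym_ext (sph_op s F).
Proof.
rewrite (sph_imgE ht hs rel_g eE) actM act_e; apply/funext => w.
case: s; rewrite /sph_rep ?opE /= ?opV_ext /=.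
- by case: w => [[[] m] n] /=; ring.
- by case: w => [[[] m] n] /=; ring.
- by case: w => [[[] m] n] /=; rewrite mulrA -invfM; congr (_^-1 * _); ring.
(* [Y2] contributes [tau^-1] times the value at [pw w], which joins the [dT] term of [Y1], as
   [dT w + tau^-1 = cT (sw w)]. *)
- transitivity (cT (sw w) * sym_ext F (pw w) + cT w * sym_ext F (pw (sw w))).
    by rewrite /opT cT_sw; ring.
  by case: w => [[[] m] n] /=; ring.
- have -> : (fun w => tau^-1 * sym_ext F (pw (pw w))) =
    fun w => tau^-1 * sym_ext (sph_op gQ2 F) w.
    by apply/funext => -[[[] m] n].
  rewrite (_ : opT _ w = tau^-1 * opT (sym_ext (sph_op gQ2 F)) w).
    by rewrite opT_ext mulKf.
  by rewrite /opT; ring.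
- have -> : (fun w => tau^-1 * sym_ext F (pVw (pVw w))) =
    fun w => tau^-1 * sym_ext (sph_op gQ2V F) w.
    by apply/funext => -[[[] m] n].
  rewrite (_ : opT _ w = tau^-1 * opT (sym_ext (sph_op gQ2V F)) w).
    by rewrite opT_ext mulKf.
  by rewrite /opT; ring.
- transitivity (Q * (x2 w * cT (sw w) * sym_ext F (pw w)
                     + x1 w * cT w * sym_ext F (pw (sw w)))).
    (* This is [V X2 = X1 T], with [T] acting as [tau] on a swap-invariant function. *)
    have E f w' : (forall w, f (sw w) = f w) ->
      opV (fun w => x2 w * f w) w' = tau * (x1 w' * f w').
      move=> fs; rewrite /opV /opT /cT fs x2_sw.
      have -> : dT w' * (x2 w' * f w') =
          (dT w' * (x2 w' - x1 w')) * f w' + dT w' * x1 w' * f w' by ring.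
      by rewrite dT_sub; ring.
    rewrite E; last exact: sym_ext_sw.
    rewrite /opT !x1_pw x2_sw cT_sw (rmorphM io) rmorphV //=.
    by field.
  by case: w => [[[] m] n] /=; ring.
Qed.

Local Notation C := (corner (Idempotent pe)).

Lemma act_val_mul (x y : C) f :
  act (val (x * y)) f = act (val x) (act (val y) f).
Proof. exact: actM. Qed.

Lemma act_img_exp s n F :
  act (val (img s ^+ n)) (sym_ext F) = sym_ext (iter n (sph_op s) F).
Proof.
elim: n => [|n IH]; first by rewrite expr0; apply: act_e.
by rewrite exprS act_val_mul IH act_img.
Qed.

Definition zop (x xV : sph_gen) (n : int) (F : int -> int -> K) :=
  match n with
  | Posz m => iter m (sph_op x) F
  | Negz m => iter m.+1 (sph_op xV) F
  end.

Lemma act_img_zpow s sV n F :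
  act (val (zpow (img s) (img sV) n)) (sym_ext F) = sym_ext (zop s sV n F).
Proof. by case: n => n; apply: act_img_exp. Qed.

Lemma act_mon a1 a2 eps b1 b2 F :
  act (val (mon img (a1, a2, eps, b1, b2))) (sym_ext F) =
  sym_ext (iter a1 (sph_op gQ1) (zop gQ2 gQ2V a2 (iter eps (sph_op gR)
    (iter b1 (sph_op gP1) (zop gP2 gP2V b2 F))))).
Proof.
by rewrite /mon !act_val_mul !(act_img_zpow, act_img_exp).
Qed.

Lemma sph_op_scale s x F :
  sph_op s (fun m n => x * F m n) = fun m n => x * sph_op s F m n.
Proof. by case: s; apply/funext => m; apply/funext => n /=; ring. Qed.

Lemma sph_op_scale_iter s j x F :
  iter j (sph_op s) (fun m n => x * F m n) =
  fun m n => x * iter j (sph_op s) F m n.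
Proof. by elim: j => //= j ->; rewrite sph_op_scale. Qed.

Lemma zop_Q2 i F : zop gQ2 gQ2V i F = fun m n => F (m + i) (n + i).
Proof.
case: i => i /=.
  elim: i => [|i IH] /=; apply/funext => m; apply/funext => n.
    by rewrite !addr0.
  by rewrite IH -!addrA -!intS.
have -> : iter i (sph_op gQ2V) F = fun m n => F (m - i%:Z) (n - i%:Z).
  elim: i => [|i IH] /=; apply/funext => m; apply/funext => n.
    by rewrite !subr0.
  by rewrite IH -!addrA -!opprD -!intS.
apply/funext => m; apply/funext => n.
by rewrite NegzE -!addrA -!opprD -!intS.
Qed.

(** Supported at [(a, b)] and its swap, so that the [P] factors act on it by the scalars [a + b] and
    [a b]. *)
Definition delta0 (m n : int) : K := ((m == 0) && (n == 0))%:R.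

Lemma iter_scale_delta s x j :
  (forall m n, sph_op s delta0 m n = x * delta0 m n) ->
  iter j (sph_op s) delta0 = fun m n => x ^+ j * delta0 m n.
Proof.
move=> sx; elim: j => [|j IH] /=.
  by apply/funext => m; apply/funext => n; rewrite mul1r.
rewrite IH sph_op_scale; apply/funext => m; apply/funext => n.
by rewrite sx mulrA exprSr.
Qed.

Lemma sph_op_delta x y m n : (m = 0 -> n = 0 -> x = y) ->
  x * delta0 m n = y * delta0 m n.
Proof.
rewrite /delta0 => xy; case: eqP => [m0|] /=; rewrite ?mulr0 //.
by case: eqP => [n0|]; rewrite ?mulr0 // xy.
Qed.

Lemma tail_delta b1 b2 :
  iter b1 (sph_op gP1) (zop gP2 gP2V b2 delta0) =
  fun m n => (a + b) ^+ b1 * (a * b) ^ b2 * delta0 m n.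
Proof.
have P1d m n : sph_op gP1 delta0 m n = (a + b) * delta0 m n.
  by apply: sph_op_delta => -> ->; rewrite expr0z !mul1r.
have P2d m n : sph_op gP2 delta0 m n = (a * b) * delta0 m n.
  by apply: sph_op_delta => -> ->; rewrite expr0z !mul1r.
have P2Vd m n : sph_op gP2V delta0 m n = (a * b)^-1 * delta0 m n.
  by apply: sph_op_delta => -> ->; rewrite expr0z !mul1r.
have -> : zop gP2 gP2V b2 delta0 = fun m n => (a * b) ^ b2 * delta0 m n.
  case: b2 => j; first exact: iter_scale_delta.
  apply: etrans (iter_scale_delta j.+1 P2Vd) _.
  by apply/funext => m; apply/funext => n; rewrite exprVn.
rewrite sph_op_scale_iter (iter_scale_delta _ P1d).
by apply/funext => m; apply/funext => n; rewrite mulrCA mulrA.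
Qed.

(* A monomial maps [delta0] to the function [shape], times the value of its [P]
   factors at [(a, b)].  The support of [shape] lies in a triangle; the values
   at the two extremal vertices separate [eps = 0] from [eps = 1]. *)
Definition shape a1 a2 (eps : bool) : int -> int -> K :=
  iter a1 (sph_op gQ1)
    (fun m n => iter eps (sph_op gR) delta0 (m + a2) (n + a2)).

Lemma act_mon_delta a1 a2 eps b1 b2 :
  act (val (mon img (a1, a2, eps, b1, b2))) (sym_ext delta0) =
  sym_ext (fun m n => (a + b) ^+ b1 * (a * b) ^ b2 * shape a1 a2 eps m n).
Proof.
by rewrite act_mon tail_delta sph_op_scale_iter zop_Q2 sph_op_scale_iter.
Qed.

Lemma shapeS a1 a2 eps m n : shape a1.+1 a2 eps m n =
  c m n * shape a1 a2 eps (m + 1) n + c' m n * shape a1 a2 eps m (n + 1).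
Proof. by []. Qed.

Lemma delta0_neq0 m n : delta0 m n != 0 -> m = 0 /\ n = 0.
Proof.
rewrite /delta0; case: (m =P 0) => [->|_] /=; last by rewrite eqxx.
by case: (n =P 0) => [->|_]; rewrite ?eqxx.
Qed.

Lemma add2_neq0 (x y x' y' : K) :
  x * y + x' * y' != 0 -> y != 0 \/ y' != 0.
Proof.
move=> h; apply/orP; apply: contraNT h.
by rewrite negb_or !negbK => /andP[/eqP-> /eqP->]; rewrite !mulr0 addr0.
Qed.

(** Each [Q2] moves the support by [-1] in both coordinates; each [Q1] or [R] moves it by [-1] in
    one of them. *)
Lemma shape_supp a1 a2 eps m n : shape a1 a2 eps m n != 0 ->
  [/\ m <= - a2, n <= - a2 & m + n + a2 + a2 + (a1 + eps)%N%:Z = 0].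
Proof.
elim: a1 m n => [|a1 IH] m n.
  case: eps; rewrite /shape add0n /=; last first.
    by move=> /delta0_neq0[h1 h2]; clear -h1 h2; split; lia.
  rewrite mulf_eq0 negb_or => /andP[_] /add2_neq0[] /delta0_neq0[h1 h2];
    clear -h1 h2; split; lia.
rewrite shapeS => /add2_neq0[] /IH[h1 h2 h3];
  by split; clear -h1 h2 h3; case: eps h3 => /= h3; lia.
Qed.

Lemma cT_shift s m n i : cT (s, m + i, n + i) = cT (s, m, n).
Proof.
rewrite /cT /dT /x1 /x2 !(expfzDr _ _ Q0) ![Q ^ _ * Q ^ i]mulrC -!mulrA.
have Qi : Q ^ i != 0 by rewrite expfz_neq0.
have := x2B1_neq0 (s, m, n); rewrite /x1 /x2.
move: (Q ^ n * _) (Q ^ m * _) (Q ^ i) Qi => x y z z0 xy.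
by congr (_ - _); field; rewrite xy tau0 -mulrBr mulf_neq0.
Qed.

Lemma shape_supp0 a1 a2 eps m n : ~~ (m <= - a2) || ~~ (n <= - a2) ->
  shape a1 a2 eps m n = 0.
Proof.
by apply: contraTeq => /shape_supp[-> ->].
Qed.

(** The factor [Q] of [gR] cancels [Q^m] at [m = -1] and leaves [a] alone. *)
Lemma opR_delta1 : sph_op gR delta0 (-1) 0 = a * c (-1) 0.
Proof.
rewrite /= (_ : delta0 (-1 + 1) 0 = 1) // (_ : delta0 (-1) (0 + 1) = 0) //.
by rewrite mulr0 addr0 mulr1 -[Q ^ (-1)]/(Q^-1); field.
Qed.

Lemma opR_delta2 : sph_op gR delta0 0 (-1) = b * c' 0 (-1).
Proof.
rewrite /= (_ : delta0 0 (-1 + 1) = 1) // (_ : delta0 (0 + 1) (-1) = 0) //.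
by rewrite mulr0 add0r mulr1 -[Q ^ (-1)]/(Q^-1); field.
Qed.

(** At this vertex all steps are taken in the first coordinate, so a single product of coefficients
    contributes; [R] leaves its trace in [a ^+ eps]. *)
Lemma shape_lead1 a1 a2 (eps : bool) :
  shape a1 a2 eps (- a2 - (a1 + eps)%N%:Z) (- a2) =
  a ^+ eps * \prod_(r < a1 + eps) c (- r.+1%:Z) 0.
Proof.
elim: a1 => [|a1 IH].
  rewrite add0n /shape; case: eps; last first.
    by rewrite big_ord0 subr0 /= addNr /delta0 eqxx mulr1.
  rewrite big_ord1 expr1.
  apply: etrans (congr2 (sph_op gR delta0) _ _) opR_delta1.
    by rewrite addrAC addNr add0r.
  exact: addNr.
rewrite shapeS [X in _ + _ * X]shape_supp0; last first.
  by apply/orP; right; clear; lia.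
rewrite mulr0 addr0 addSn big_ord_recr /= mulrA [RHS]mulrC -IH.
congr (_ * shape _ _ _ _ _); last by rewrite -addn1 PoszD; clear; lia.
by rewrite -[RHS](cT_shift _ _ _ (- a2)) add0r addrC.
Qed.

Lemma shape_lead2 a1 a2 (eps : bool) :
  shape a1 a2 eps (- a2) (- a2 - (a1 + eps)%N%:Z) =
  b ^+ eps * \prod_(r < a1 + eps) c' 0 (- r.+1%:Z).
Proof.
elim: a1 => [|a1 IH].
  rewrite add0n /shape; case: eps; last first.
    by rewrite big_ord0 subr0 /= addNr /delta0 eqxx mulr1.
  rewrite big_ord1 expr1.
  apply: etrans (congr2 (sph_op gR delta0) _ _) opR_delta2.
    exact: addNr.
  by rewrite addrAC addNr add0r.
rewrite shapeS [X in _ * X + _]shape_supp0; last first.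
  by apply/orP; left; clear; lia.
rewrite mulr0 add0r addSn big_ord_recr /= mulrA [RHS]mulrC -IH.
congr (_ * shape _ _ _ _ _); last by rewrite -addn1 PoszD; clear; lia.
by rewrite -[RHS](cT_shift _ _ _ (- a2)) add0r addrC.
Qed.

Hypothesis ab_free : forall (s : seq (nat * int)) (x : nat * int -> k),
  uniq s ->
  \sum_(p <- s) io (x p) * ((a + b) ^+ p.1 * (a * b) ^ p.2) = 0 ->
  forall p, p \in s -> x p = 0.

Local Notation J := (nat * int * bool * nat * int)%type.

Lemma act_sum (s : seq J) (x : J -> k) f w :
  act (val (\sum_(j <- s) algin (x j) * mon img j)) f w =
  \sum_(j <- s) io (x j) * act (val (mon img j)) f w.
Proof.
elim: s => [|j s IH].
  by rewrite !big_nil; apply: act0.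
rewrite !big_cons -IH [val _]cornerDE actD.
by rewrite [X in act X _ _](cornerZE _) actM act_algin.
Qed.

Lemma mon_free (s : seq J) (x : J -> k) : uniq s ->
  \sum_(j <- s) algin (x j) * mon img j = 0 -> forall j, j \in s -> x j = 0.
Proof.
move=> us s0.
pose val_at (j : J) m n := let: (a1, a2, eps, b1, b2) := j in
  (a + b) ^+ b1 * (a * b) ^ b2 * shape a1 a2 eps m n.
have sum0 m n : \sum_(j <- s) io (x j) * val_at j m n = 0.
  have := act_sum s x (sym_ext delta0) (false, m, n).
  rewrite s0 [LHS](act0 _ _) => E; rewrite [RHS]E.
  apply: eq_bigr => -[[[[a1 a2] eps] b1] b2] _.
  by rewrite act_mon_delta.
pose lvl (j : J) : int := j.1.1.1.2.
pose eps (j : J) : bool := j.1.1.2.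
pose deg (j : J) : nat := (j.1.1.1.1 + eps j)%N.
pose sc (j : J) := (a + b) ^+ j.1.2 * (a * b) ^ j.2.
pose shp (j : J) := shape j.1.1.1.1 (lvl j) (eps j).
have valE j m n : val_at j m n = sc j * shp j m n.
  by case: j => [[[[a1 a2] ep] b1] b2].
pose M := (\sum_(j <- s) `|lvl j|)%N.
have leM j : j \in s -> (`|lvl j| <= M)%N.
  by move=> js; rewrite /M (big_rem j) //= leq_addr.
(* Induction on the exponent of [Q2] upwards from [-M], below which there are no terms. *)
clearbody M; suff lvl_ind n j : j \in s -> lvl j < n%:Z - M%:Z -> x j = 0.
  move=> j js; apply: (lvl_ind (`|lvl j| + M).+1 j js); clear; lia.
elim: n j => [|n IH] j js ltj.
  by move: (lvl j) (leM j js) ltj => l; clear; lia.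
have [lt|ge] := ltP (lvl j) (n%:Z - M%:Z); first exact: IH.
have lvlj : lvl j = n%:Z - M%:Z.
  by move: (lvl j) ltj ge => l; clear; lia.
(* Once the terms with smaller exponent of [Q2] are gone, only these are nonzero at the two extremal
   vertices of [j]. *)
pose P j' := (lvl j' == lvl j) && (deg j' == deg j).
have sumP y m' n' G : G != 0 ->
    (forall j', P j' -> shp j' m' n' = y ^+ eps j' * G) ->
    (forall j', lvl j <= lvl j' -> shp j' m' n' != 0 -> P j') ->
  \sum_(j' <- s | P j') io (x j') * sc j' * y ^+ eps j' = 0.
  move=> G0 PE PN; apply: (mulIf G0); rewrite mul0r -[RHS](sum0 m' n').
  rewrite mulr_suml [RHS](bigID P) /= [X in _ = _ + X]big1_seq ?addr0.
    by apply: eq_bigr => j' Pj'; rewrite valE PE // !mulrA.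
  move=> j' /andP[nP js']; have [lt|le] := ltP (lvl j') (lvl j).
    by rewrite IH ?rmorph0 ?mul0r // -lvlj.
  rewrite valE [shp _ _ _](_ : _ = 0) ?mulr0 //; apply: contraNeq nP.
  exact: PN.
have sumA : \sum_(j' <- s | P j') io (x j') * sc j' * a ^+ eps j' = 0.
  apply: (sumP a (- lvl j - (deg j)%:Z) (- lvl j)
    (\prod_(r < deg j) c (- r.+1%:Z) 0)).
  - by apply/prodf_neq0 => r _; apply: cT_neq0.
  - by move=> j' /andP[/eqP <- /eqP <-]; apply: shape_lead1.
  (* The bound on the second coordinate gives [lvl j' <= lvl j], hence equality; the sum of the
     coordinates then determines the degree. *)
  - move=> j' le /shape_supp[_]; rewrite -/(deg j') /P.
    by move: (lvl j) (lvl j') (deg j) (deg j') le => l l' d d'; clear; lia.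
have sumB : \sum_(j' <- s | P j') io (x j') * sc j' * b ^+ eps j' = 0.
  apply: (sumP b (- lvl j) (- lvl j - (deg j)%:Z)
    (\prod_(r < deg j) c' 0 (- r.+1%:Z))).
  - by apply/prodf_neq0 => r _; apply: cT_neq0.
  - by move=> j' /andP[/eqP <- /eqP <-]; apply: shape_lead2.
  - move=> j' le /shape_supp[+ _]; rewrite -/(deg j') /P.
    by move: (lvl j) (lvl j') (deg j) (deg j') le => l l' d d'; clear; lia.
pose S ep := \sum_(j' <- s | P j' && (eps j' == ep)) io (x j') * sc j'.
have splitS y : \sum_(j' <- s | P j') io (x j') * sc j' * y ^+ eps j' =
    S true * y + S false.
  rewrite (bigID eps) /= mulr_suml; congr (_ + _).
    apply: eq_big => [j'|j' /andP[_ ->]]; last by rewrite expr1.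
    by rewrite eqb_id.
  apply: eq_big => [j'|j' /andP[_ /negbTE ->]]; last by rewrite mulr1.
  by rewrite eqbF_neg.
have S1 : S true = 0.
  have : S true * (a - b) = 0.
    transitivity (S true * a + S false - (S true * b + S false)); first by ring.
    by rewrite -!splitS sumA sumB subrr.
  move=> /eqP; rewrite mulf_eq0 subr_eq0 => /orP[/eqP //|ab].
  by have := a_neq_b 1; rewrite rmorph1 mul1r ab.
have S0 : S false = 0 by rewrite -[RHS]sumA splitS S1 mul0r add0r.
have Sj : S (eps j) = 0 by case: (eps j).
(* [a1 + eps] and [eps] determine [a1], so within [Q'] only the exponents of [P1] and [P2] vary. *)
pose Q' j' := P j' && (eps j' == eps j).
have QE j' : Q' j' -> j' = (j.1.1, j'.1.2, j'.2).
  rewrite /Q' /P /deg /lvl /eps.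
  case: j' (j) => [[[[a1 a2] ep] b1] b2] [[[[? ?] ?] ?] ?] /=.
  move=> /andP[/andP[/eqP -> /eqP dj] /eqP ej].
  by move: dj; rewrite ej => /addIn ->.
have us' : uniq [seq (j'.1.2, j'.2) | j' <- s & Q' j'].
  rewrite map_inj_in_uniq ?filter_uniq // => j1 j2.
  rewrite !mem_filter => /andP[/QE E1 _] /andP[/QE E2 _] [e1 e2].
  by rewrite E1 E2 e1 e2.
have := ab_free (x := fun p => x (j.1.1, p.1, p.2)) us'.
have Qj : Q' j by rewrite /Q' /P !eqxx.
rewrite big_map big_filter => /(_ _ (j.1.2, j.2)) /=.
rewrite -(QE j Qj); apply.
  by rewrite -[RHS]Sj; apply: eq_bigr => j' /QE {1}<-.
by apply/mapP; exists j; rewrite ?mem_filter ?Qj.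
Qed.

End GenericRepresentation.

(** * The isomorphism and the basis *)

Lemma teval_gen (k : comNzRingType) (I : Type)
  (rel : term k I -> term k I -> Prop) x : teval (gen rel) x = cls rel x.
Proof.
by elim: x => //= [x -> y ->|x -> y ->]; rewrite (cls_add, cls_mul).
Qed.

Lemma gen_respects (k : comNzRingType) (I : Type)
  (rel : term k I -> term k I -> Prop) : respects rel (gen rel).
Proof. by move=> x y xy; rewrite !teval_gen; apply/clsP/cg_rel. Qed.

Lemma rmorph_zpow (A B : pzRingType) (f : {rmorphism A -> B}) x xV n :
  f (zpow x xV n) = zpow (f x) (f xV) n.
Proof. by case: n => n; rewrite /= rmorphXn. Qed.

Lemma ground_ring_q_unit (R : realType) (k : comUnitRingType) (t q : k) :
  ground_ring R t q -> q \is a GRing.unit.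
Proof. by case=> [|{}t {}q t0 q0 s0]; [exact: Rtq_q_unit | rewrite unitfE]. Qed.

Lemma ground_ring_embed (R : realType) (k : comUnitRingType) (t q : k) :
  ground_ring R t q ->
  exists (L : fieldType) (f : {rmorphism k -> L}), injective f.
Proof.
case=> [|{}t {}q _ _ _].
  by exists {fraction {poly {poly R[i]}}}, val; apply: val_inj.
by exists R[i], idfun; apply: inj_id.
Qed.

Section Embedding.
Variables (k : comUnitRingType) (t q : k).
Hypotheses (ht : t \is a GRing.unit) (hq : q \is a GRing.unit).
Hypothesis (hs : t ^+ 2 + 1 \is a GRing.unit).
Variables (L : fieldType) (f : {rmorphism k -> L}).
Hypothesis f_inj : injective f.
Variable pe : sph_e t q * sph_e t q = sph_e t q.

Local Notation g := (dgen t q).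
Local Notation img := (sph_img t g pe).
Local Notation C := (corner (Idempotent pe)).

Let rel_g : respects (daha_rel t q) g.
Proof. exact: gen_respects. Qed.

Let rel_img : respects (sph_rel t q) img.
Proof. exact: (@sph_img_rel _ _ _ ht hq hs _ _ rel_g _ erefl pe). Qed.

Definition sph_hom : {rmorphism sph_alg t q -> C} := plift rel_img.

Lemma sph_hom_gen s : sph_hom (sgen t q s) = img s.
Proof. exact: plift_gen. Qed.

Lemma sph_hom_algin c : sph_hom (algin c) = algin c.
Proof. exact: plift_algin. Qed.

Lemma sph_hom_mon j : sph_hom (sph_mon t q j) = mon img j.
Proof.
case: j => [[[[a1 a2] eps] b1] b2].
by rewrite /sph_mon /mon !rmorphM !rmorphXn !rmorph_zpow !sph_hom_gen.
Qed.

Lemma sph_mon_free (s : seq (nat * int * bool * nat * int)) (c : _ -> k) :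
  uniq s -> \sum_(j <- s) algin (c j) * sph_hom (sph_mon t q j) = 0 ->
  forall j, j \in s -> c j = 0.
Proof.
move=> us; under eq_bigr do rewrite sph_hom_mon; move: us.
(* Scalars become constants, while the two indeterminates serve as the generic point. *)
pose io : {rmorphism k -> {fraction {poly {poly L}}}} :=
  @tofrac {poly {poly L}} \o (@polyC {poly L} \o (@polyC L \o f)).
have aX c0 : genX L != io c0 * genY L by apply: genX_neq_genY.
have bY c0 : genY L != io c0 * genX L by apply: genY_neq_genX.
have opl := daha_op_linear t q io (genX L) (genY L).
have opr := daha_op_rel ht hq (genX_neq0 L) (genY_neq0 L) aX bY.
apply: (mon_free ht hq aX bY rel_g erefl
  (actionD opl opr) (actionM opl opr) (action_algin opl opr)
  (action_gen opl opr) hs).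
move=> s' x us' s0 p ps; apply: f_inj; rewrite rmorph0.
exact: (genX_genY_free (c := fun p => f (x p)) us' s0).
Qed.

Lemma sph_mon_spans x : spans (sph_mon t q) x.
Proof.
elim/clsW: x => x; rewrite -teval_gen.
exact: (mon_teval hq (@gen_respects _ _ (sph_rel t q))).
Qed.

Lemma sph_hom_inj : injective sph_hom.
Proof.
move=> x y xy; apply: subr0_eq.
have : sph_hom (x - y) = 0 by rewrite rmorphB xy subrr.
have [s [c [us ->]]] := spans_uniq (sph_mon_spans (x - y)).
rewrite rmorph_sum /= => s0; rewrite big_seq big1 // => j js.
rewrite (sph_mon_free us _ js) ?rmorph0 ?mul0r // -[RHS]s0.
by apply: eq_bigr => j' _; rewrite rmorphM sph_hom_algin.
Qed.

Lemma sph_hom_surj y : exists x, sph_hom x = y.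
Proof.
suff [x xy] : exists x, val (sph_hom x) = val y by exists x; apply: val_inj.
have [h hE] : exists h, val y = sph_e t q * h * sph_e t q.
  by have /asboolP := valP y.
move: h hE; elim/clsW => h; rewrite -teval_gen.
apply: (I_corner ht hq hs rel_g erefl (pe := pe)
  (I := fun z => exists x, val (sph_hom x) = z)).
- by move=> _ _ [x <-] [x' <-]; exists (x + x'); rewrite rmorphD.
- move=> c _ [x <-]; exists (algin c * x).
  by rewrite rmorphM sph_hom_algin; apply: cornerZE.
- by move=> _ _ [x <-] [x' <-]; exists (x * x'); rewrite rmorphM.
- by exists 1; rewrite rmorph1.
- by move=> s; exists (sgen t q s); rewrite sph_hom_gen.
Qed.

Lemma sph_hom_bij : bijective sph_hom.
Proof.
have [h hK] := choice sph_hom_surj; exists h => // x.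
by apply: sph_hom_inj; rewrite hK.
Qed.

End Embedding.

Theorem theorem2p6 (R : realType) (k : comUnitRingType) (t q : k)
    (hk : ground_ring R t q) :
  let X1 := dgen t q gX1 in let X2 := dgen t q gX2 in
  let Y1 := dgen t q gY1 in let Y2 := dgen t q gY2 in
  let eHe := corner_in (sph_idem hk) in
  exists Phi : {rmorphism sph_alg t q -> corner (sph_idem hk)},
    alg_iso Phi /\
    [/\ Phi (sgen t q gP1) = eHe (X1 + X2),
        Phi (sgen t q gP2) = eHe (X1 * X2),
        Phi (sgen t q gQ1) = eHe (Y1 + Y2),
        Phi (sgen t q gQ2) = eHe (Y1 * Y2)
      & Phi (sgen t q gR) = eHe (algin (t ^- 2) * Y1 * X1 + Y2 * X2)] /\
    is_basis (fun j => Phi (sph_mon t q j)).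
Proof.
move=> X1 X2 Y1 Y2 eHe.
have ht := ground_ring_t_unit hk; have hs := ground_ring_s_unit hk.
have hq := ground_ring_q_unit hk; have [L [f f_inj]] := ground_ring_embed hk.
exists (sph_hom ht hq hs (idemP (sph_idem hk))); split.
  by split; [exact: sph_hom_algin | exact: sph_hom_bij f_inj _].
split; first by split; exact: sph_hom_gen.
split=> [s c us s0 j js|y].
  exact: (sph_mon_free f_inj us s0 js).
have [x <-] := sph_hom_surj ht hq hs y.
have [s [c [_ ->]]] := spans_uniq (sph_mon_spans hq x); exists s, c.
rewrite rmorph_sum; apply: eq_bigr => j _.
by rewrite rmorphM sph_hom_algin.
Qed.
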